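(* For the periplectic Lie superalgebra $\mathfrak{p}_n$ over $\mathbb{C}$, the center of the universal enveloping superalgebra $\mathrm{U}(\mathfrak{p}_n)$ is trivial, i.e. $\mathcal{Z}(\mathfrak{p}_n)=\mathbb{C}\cdot 1$.
   Context: $\mathfrak{p}_n$ is the Lie superalgebra of block matrices $\begin{pmatrix}A&B\\C&-A^t\end{pmatrix}$ with $A,B,C$ complex $n\times n$ matrices, $B^t=B$, $C^t=-C$, where the diagonal blocks are even and the off-diagonal blocks are odd, with the supercommutator $[x,y]=xy-(-1)^{|x||y|}yx$. $\mathcal{Z}(\mathfrak{p}_n)=\mathrm{U}(\mathfrak{p}_n)^{\mathfrak{p}_n}$ is the (super)center of $\mathrm{U}(\mathfrak{p}_n)$: the set of elements annihilated by the adjoint (supercommutator) action of $\mathfrak{p}_n$. *)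

(* Defs.v *)
From HB Require Import structures.
From mathcomp Require Import all_boot all_order all_algebra.
From mathcomp Require Import generic_quotient.
From mathcomp Require Import boolp classical_sets reals.
From mathcomp Require Export complex.

Set Implicit Arguments.
Unset Strict Implicit.
Unset Printing Implicit Defensive.

Import Order.TTheory GRing.Theory Num.Theory.

Local Open Scope quotient_scope.
Local Open Scope ring_scope.

(* Parities are booleans ([true] is odd), added with [(+)] and multiplied
   with [&&].  A Z/2-grading is given by its two projections [hpart b], so that
   [V = V_0 (+) V_1] with [V_b] the image of [hpart b]. *)
HB.mixin Record Lmodule_isSuperspace (K : numFieldType) V
    of GRing.Lmodule K V := {
  hpart : bool -> V -> V ;
  hpart_linear : forall b, linear (hpart b) ;
  hpart_sum : forall v, hpart false v + hpart true v = v ;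
  hpart_idem : forall a b v,
    hpart a (hpart b v) = if a == b then hpart b v else 0
}.

#[short(type="superspaceType")]
HB.structure Definition Superspace (K : numFieldType) :=
  { V of GRing.Lmodule K V & Lmodule_isSuperspace K V }.

Definition homog (K : numFieldType) (V : superspaceType K) (b : bool) (v : V) :=
  hpart b v = v.

(* Characteristic 0 is built into [numFieldType], so that the identities
   [x, x] = 0 (x even) and [x, [x, x]] = 0 (x odd) follow from the axioms. *)
HB.mixin Record Superspace_isLieSuperalgebra (K : numFieldType) g
    of Superspace K g := {
  lie : g -> g -> g ;
  lie_linearl : forall y, linear (lie^~ y) ;
  lie_linearr : forall x, linear (lie x) ;
  lie_homog : forall a b (x y : g),
    homog a x -> homog b y -> homog (a (+) b) (lie x y) ;
  lie_skew : forall a b (x y : g), homog a x -> homog b y ->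
    lie x y = - ((-1) ^+ (a && b) *: lie y x) ;
  lie_jacobi : forall a b (x y z : g), homog a x -> homog b y ->
    lie x (lie y z) = lie (lie x y) z + (-1) ^+ (a && b) *: lie y (lie x z)
}.

#[short(type="lieSuperalgType")]
HB.structure Definition LieSuperalgebra (K : numFieldType) :=
  { g of Superspace K g & Superspace_isLieSuperalgebra K g }.

(* [x, y] = x y - (-1)^(|x||y|) y x, extended bilinearly.  The product is a
   parameter because matrices of size 0 are not an [algType]. *)
Definition scomm_of (K : numFieldType) (V : superspaceType K)
    (mul : V -> V -> V) (x y : V) : V :=
  \sum_(a : bool) \sum_(b : bool)
    (mul (hpart a x) (hpart b y)
       - (-1) ^+ (a && b) *: mul (hpart b y) (hpart a x)).

Section SuperspaceTheory.
Variables (K : numFieldType) (V : superspaceType K).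
Implicit Types (v w : V) (a b : bool).

HB.instance Definition _ b :=
  GRing.isLinear.Build K V V *:%R (@hpart K V b) (hpart_linear b).

Lemma homog_hpart b v : homog b (hpart b v).
Proof. by rewrite /homog hpart_idem eqxx. Qed.

Lemma homogE a b v : homog a v -> hpart b v = if b == a then v else 0.
Proof. by move=> <-; rewrite hpart_idem. Qed.

Lemma homog_linear b (k : K) v w :
  homog b v -> homog b w -> homog b (k *: v + w).
Proof. by rewrite /homog hpart_linear => -> ->. Qed.

End SuperspaceTheory.

Section SupercommutatorTheory.
Variables (K : numFieldType) (V : superspaceType K) (mul : V -> V -> V).
Hypothesis mul_linearl : forall y, linear (mul^~ y).
Hypothesis mul_linearr : forall x, linear (mul x).
Hypothesis mul_assoc : associative mul.
Hypothesis mul_homog : forall a b x y,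
  homog a x -> homog b y -> homog (a (+) b) (mul x y).
Implicit Types (x y z : V) (a b c : bool).
Local Notation scomm := (scomm_of mul).

Let mul0l y : mul 0 y = 0.
Proof. by have := mul_linearl y (-1) 0 0; rewrite !scaleN1r !addNr. Qed.
Let mulDl x x' y : mul (x + x') y = mul x y + mul x' y.
Proof. by have := mul_linearl y 1 x x'; rewrite !scale1r. Qed.
Let mulZl k x y : mul (k *: x) y = k *: mul x y.
Proof. by have := mul_linearl y k x 0; rewrite mul0l !addr0. Qed.
Let mulBl x x' y : mul (x - x') y = mul x y - mul x' y.
Proof. by rewrite mulDl -scaleN1r mulZl scaleN1r. Qed.
Let mul0r x : mul x 0 = 0.
Proof. by have := mul_linearr x (-1) 0 0; rewrite !scaleN1r !addNr. Qed.
Let mulDr x y y' : mul x (y + y') = mul x y + mul x y'.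
Proof. by have := mul_linearr x 1 y y'; rewrite !scale1r. Qed.
Let mulZr k x y : mul x (k *: y) = k *: mul x y.
Proof. by have := mul_linearr x k y 0; rewrite mul0r !addr0. Qed.
Let mulBr x y y' : mul x (y - y') = mul x y - mul x y'.
Proof. by rewrite mulDr -scaleN1r mulZr scaleN1r. Qed.

Lemma scomm_of_linearl y : linear (scomm^~ y).
Proof.
move=> k x x'; rewrite /scomm scaler_sumr -big_split; apply: eq_bigr => a _ /=.
rewrite scaler_sumr -big_split; apply: eq_bigr => b _ /=.
rewrite hpart_linear mulDl mulDr scalerDr scalerBr mulZl.
rewrite mulZr !scalerA [_ * k]mulrC opprD.
by rewrite addrACA.
Qed.

Lemma scomm_of_linearr x : linear (scomm x).
Proof.
move=> k y y'; rewrite /scomm scaler_sumr -big_split; apply: eq_bigr => a _ /=.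
rewrite scaler_sumr -big_split; apply: eq_bigr => b _ /=.
rewrite hpart_linear mulDl mulDr scalerDr scalerBr mulZl.
rewrite mulZr !scalerA [_ * k]mulrC opprD.
by rewrite addrACA.
Qed.

HB.instance Definition _ x :=
  GRing.isLinear.Build K V V *:%R (scomm x) (scomm_of_linearr x).

Lemma scomm_ofE a b x y : homog a x -> homog b y ->
  scomm x y = mul x y - (-1) ^+ (a && b) *: mul y x.
Proof.
move=> hx hy; rewrite /scomm !big_bool /=.
rewrite !(homogE _ hx) !(homogE _ hy).
by case: a {hx}; case: b {hy};
  rewrite /= ?mul0l ?mul0r ?scaler0 ?subr0 ?addr0 ?add0r.
Qed.

Lemma scomm_of_homog a b x y :
  homog a x -> homog b y -> homog (a (+) b) (scomm x y).
Proof.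
move=> hx hy; rewrite (scomm_ofE hx hy) addrC -scaleNr.
by apply: homog_linear; [rewrite addbC|]; apply: mul_homog.
Qed.

Lemma scomm_of_skew a b x y : homog a x -> homog b y ->
  scomm x y = - ((-1) ^+ (a && b) *: scomm y x).
Proof.
move=> hx hy; rewrite (scomm_ofE hx hy) (scomm_ofE hy hx) scalerBr scalerA.
by rewrite [b && a]andbC -expr2 sqrr_sign scale1r opprB.
Qed.

Lemma scomm_of_jacobi a b x y z : homog a x -> homog b y ->
  scomm x (scomm y z) =
    scomm (scomm x y) z + (-1) ^+ (a && b) *: scomm y (scomm x z).
Proof.
move=> hx hy; rewrite -(hpart_sum z).
have aux c (w : V) : homog c w -> scomm x (scomm y w) =
    scomm (scomm x y) w + (-1) ^+ (a && b) *: scomm y (scomm x w).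
  move=> hw.
  rewrite (scomm_ofE hx (scomm_of_homog hy hw)) (scomm_ofE (scomm_of_homog hx hy) hw).
  rewrite (scomm_ofE hy (scomm_of_homog hx hw)).
  rewrite (scomm_ofE hx hy) (scomm_ofE hx hw) (scomm_ofE hy hw).
  have zid (M : zmodType) (X1 X2 X3 X4 X5 X6 : M) :
      X1 - X2 - (X3 - X4) = X1 - X5 - (X6 - X4) + (X5 - X3 - (X2 - X6)).
    rewrite !opprB [RHS]addrACA !subrKA addrACA [RHS]addrACA.
    by rewrite [- X2 - X3]addrC.
  rewrite !(mulBl, mulBr, scalerBr, mul_assoc, mulZl, mulZr, scalerA).
  rewrite [LHS](zid _ _ _ _ _ ((-1) ^+ (a && b) *: mul (mul y x) w)
             ((-1) ^+ ((a (+) b) && c) *: mul (mul w x) y)).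
  by congr (_ - _ - (_ - _) + (_ - _ - (_ - _)));
     case: (a); case: (b); case: (c);
     rewrite /= ?expr0 ?expr1 ?mulr1 ?mul1r ?mulrNN ?mulr1 ?mulrN1 ?opprK.
by rewrite !linearD /= (aux _ _ (homog_hpart false z))
           (aux _ _ (homog_hpart true z)) addrACA.
Qed.

End SupercommutatorTheory.

HB.mixin Record Algebra_isSuperalgebra (K : numFieldType) A
    of GRing.Algebra K A & Superspace K A := {
  homog_one : homog false (1 : A) ;
  homog_mul : forall a b (x y : A),
    homog a x -> homog b y -> homog (a (+) b) (x * y)
}.

#[short(type="superalgType")]
HB.structure Definition Superalgebra (K : numFieldType) :=
  { A of GRing.Algebra K A & Superspace K A & Algebra_isSuperalgebra K A }.

Definition scomm (K : numFieldType) (A : superalgType K) : A -> A -> A :=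
  scomm_of *%R.

Lemma scommE (K : numFieldType) (A : superalgType K) a b (x y : A) :
  homog a x -> homog b y -> scomm x y = x * y - (-1) ^+ (a && b) *: (y * x).
Proof.
apply: scomm_ofE => [z k u v|z k u v]; first by rewrite mulrDl -scalerAl.
by rewrite mulrDr -scalerAr.
Qed.

(* gl(m|n): block matrices, block-diagonal part even. *)
Definition supermx (K : numFieldType) (m n : nat) := 'M[K]_(m + n).

Section SuperMatrices.
Variables (K : numFieldType) (m n : nat).
Implicit Types (X Y : 'M[K]_(m + n)).

HB.instance Definition _ := GRing.Lmodule.on (supermx K m n).

Definition mx_hpart (b : bool) X : 'M[K]_(m + n) :=
  if b then block_mx 0 (ursubmx X) (dlsubmx X) 0
  else block_mx (ulsubmx X) 0 0 (drsubmx X).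

Lemma mx_hpart_linear b : linear (mx_hpart b).
Proof.
move=> k X Y; rewrite /mx_hpart.
case: b; rewrite scale_block_mx add_block_mx !scaler0 !addr0;
  by rewrite /ulsubmx /ursubmx /dlsubmx /drsubmx !linearP.
Qed.

Lemma mx_hpart_sum X : mx_hpart false X + mx_hpart true X = X.
Proof. by rewrite /mx_hpart add_block_mx !addr0 !add0r submxK. Qed.

Lemma mx_hpart_idem a b X :
  mx_hpart a (mx_hpart b X) = if a == b then mx_hpart b X else 0.
Proof.
rewrite /mx_hpart; case: a; case: b => /=;
  rewrite ?(block_mxKul, block_mxKur, block_mxKdl, block_mxKdr) //;
  exact: block_mx0.
Qed.

HB.instance Definition _ := Lmodule_isSuperspace.Build K (supermx K m n)
  mx_hpart_linear mx_hpart_sum mx_hpart_idem.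

Definition mx_scomm : supermx K m n -> supermx K m n -> supermx K m n :=
  scomm_of (fun X Y : supermx K m n => (X : 'M_(m + n)) *m Y).

Lemma mx_homogE b (X : supermx K m n) : homog b X -> X = mx_hpart b X.
Proof. by []. Qed.

Lemma mulmx_homog a b (X Y : supermx K m n) : homog a X -> homog b Y ->
  homog (a (+) b) ((X : 'M_(m + n)) *m Y : supermx K m n).
Proof.
move=> <- <-; rewrite /homog /hpart /= /mx_hpart.
case: a; case: b => /=; rewrite mulmx_block !(mul0mx, mulmx0, addr0, add0r);
  by rewrite !(block_mxKul, block_mxKur, block_mxKdl, block_mxKdr).
Qed.

End SuperMatrices.

Section Periplectic.
Variables (K : numFieldType) (n : nat).
Implicit Types (X Y : 'M[K]_(n + n)).

Definition is_periplectic : {pred 'M[K]_(n + n)} := fun X =>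
  [&& drsubmx X == - (ulsubmx X)^T,
      (ursubmx X)^T == ursubmx X & (dlsubmx X)^T == - dlsubmx X].

Lemma is_periplecticP X :
  reflect (exists A B C : 'M[K]_n,
             [/\ X = block_mx A B C (- A^T), B^T = B & C^T = - C])
          (X \in is_periplectic).
Proof.
apply: (iffP and3P) => [[/eqP dX /eqP uX /eqP lX]|[A [B [C [-> sB sC]]]]].
  by exists (ulsubmx X), (ursubmx X), (dlsubmx X); rewrite -dX submxK.
by rewrite block_mxKul block_mxKur block_mxKdl block_mxKdr sB sC !eqxx.
Qed.

Lemma periplectic_submod : submod_closed is_periplectic.
Proof.
split=> [|k X Y].
  apply/is_periplecticP; exists 0, 0, 0.
  by rewrite !trmx0 oppr0 block_mx0.
move=> /is_periplecticP[A [B [C [-> sB sC]]]].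
move=> /is_periplecticP[A' [B' [C' [-> sB' sC']]]].
apply/is_periplecticP.
exists (k *: A + A'), (k *: B + B'), (k *: C + C').
rewrite scale_block_mx add_block_mx !linearP /= sB sB' sC sC'; split=> //; congr block_mx; rewrite ?linearP ?scalerN ?opprD //.
Qed.

HB.instance Definition _ :=
  GRing.isSubmodClosed.Build K 'M[K]_(n + n) is_periplectic periplectic_submod.

Lemma mx_hpart_periplectic b X :
  X \in is_periplectic -> mx_hpart b X \in is_periplectic.
Proof.
move=> /is_periplecticP[A [B [C [-> sB sC]]]]; rewrite /mx_hpart.
rewrite block_mxKul block_mxKur block_mxKdl block_mxKdr.
apply/is_periplecticP; case: b; [exists 0, B, C|exists A, 0, 0];
  by rewrite ?trmx0 ?oppr0.
Qed.

Lemma mx_scomm_periplectic X Y : X \in is_periplectic ->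
  Y \in is_periplectic -> mx_scomm X Y \in is_periplectic.
Proof.
move=> /is_periplecticP[A [B [C [-> sB sC]]]].
move=> /is_periplecticP[A' [B' [C' [-> sB' sC']]]].
rewrite /mx_scomm /scomm_of !big_bool /hpart /= /mx_hpart /=.
rewrite !(block_mxKul, block_mxKur, block_mxKdl, block_mxKdr).
rewrite ?expr0 ?expr1 ?scale1r ?scaleN1r ?opprK.
rewrite !mulmx_block !(mul0mx, mulmx0, addr0, add0r).
rewrite !(opp_block_mx, add_block_mx) !(addr0, add0r, oppr0).
have tD (M N : 'M[K]_n) : (M + N)^T = M^T + N^T by rewrite linearD.
have tN (M : 'M[K]_n) : (- M)^T = - M^T by rewrite linearN.
apply/is_periplecticP; do 3!eexists; split; first congr block_mx;
  rewrite !(tD, tN, trmx_mul, trmxK, sB, sB', sC, sC', mulmxN, mulNmx, opprK);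
  rewrite ?opprD ?opprK.
- by congr (_ + _); rewrite addrC.
- by congr (_ + _); rewrite addrC.
- by congr (_ + _); rewrite addrC.
Qed.

(* The periplectic Lie superalgebra, a subspace of gl(n|n) stable under its
   supercommutator. *)
Record periplectic := Periplectic {
  periplectic_mx :> 'M[K]_(n + n);
  _ : periplectic_mx \in is_periplectic
}.

HB.instance Definition _ := [isSub for periplectic_mx].
HB.instance Definition _ := [Choice of periplectic by <:].
HB.instance Definition _ := [SubChoice_isSubLmodule of periplectic by <:].

Implicit Types (x y z : periplectic).

Definition periplectic_hpart b x : periplectic :=
  Periplectic (mx_hpart_periplectic b (valP x)).
Definition periplectic_lie x y : periplectic :=
  Periplectic (mx_scomm_periplectic (valP x) (valP y)).

Lemma periplectic_hpart_linear b : linear (periplectic_hpart b).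
Proof. by move=> k x y; apply/val_inj; rewrite /= mx_hpart_linear. Qed.

Lemma periplectic_hpart_sum x :
  periplectic_hpart false x + periplectic_hpart true x = x.
Proof. by apply/val_inj; rewrite /= mx_hpart_sum. Qed.

Lemma periplectic_hpart_idem a b x :
  periplectic_hpart a (periplectic_hpart b x) =
    if a == b then periplectic_hpart b x else 0.
Proof. by apply/val_inj; rewrite /= mx_hpart_idem; case: eqP. Qed.

HB.instance Definition _ := Lmodule_isSuperspace.Build K periplectic
  periplectic_hpart_linear periplectic_hpart_sum periplectic_hpart_idem.

Let mulmx_linearl Y : linear ((@mulmx K (n + n) (n + n) (n + n))^~ Y).
Proof. by move=> k X X'; rewrite mulmxDl scalemxAl. Qed.
Let mulmx_linearr X : linear (@mulmx K (n + n) (n + n) (n + n) X).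
Proof. by move=> k Y Y'; rewrite linearP. Qed.

Lemma periplectic_homog b x : homog b x ->
  homog b (periplectic_mx x : supermx K n n).
Proof. by move=> hx; rewrite /homog -[in RHS]hx. Qed.

Lemma periplectic_lie_linearl y : linear (periplectic_lie^~ y).
Proof.
move=> k x x'; apply/val_inj => /=.
exact: (@scomm_of_linearl K (supermx K n n) _ mulmx_linearl mulmx_linearr).
Qed.

Lemma periplectic_lie_linearr x : linear (periplectic_lie x).
Proof.
move=> k y y'; apply/val_inj => /=.
exact: (@scomm_of_linearr K (supermx K n n) _ mulmx_linearl mulmx_linearr).
Qed.

Lemma periplectic_lie_homog a b x y :
  homog a x -> homog b y -> homog (a (+) b) (periplectic_lie x y).
Proof.
move=> /periplectic_homog hx /periplectic_homog hy; apply/val_inj => /=.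
exact: (@scomm_of_homog K (supermx K n n) _ mulmx_linearl mulmx_linearr
          (@mulmx_homog K n n) _ _ _ _ hx hy).
Qed.

Lemma periplectic_lie_skew a b x y : homog a x -> homog b y ->
  periplectic_lie x y = - ((-1) ^+ (a && b) *: periplectic_lie y x).
Proof.
move=> /periplectic_homog hx /periplectic_homog hy; apply/val_inj => /=.
exact: (@scomm_of_skew K (supermx K n n) _ mulmx_linearl mulmx_linearr
          _ _ _ _ hx hy).
Qed.

Lemma periplectic_lie_jacobi a b x y z : homog a x -> homog b y ->
  periplectic_lie x (periplectic_lie y z) =
    periplectic_lie (periplectic_lie x y) z
      + (-1) ^+ (a && b) *: periplectic_lie y (periplectic_lie x z).
Proof.
move=> /periplectic_homog hx /periplectic_homog hy; apply/val_inj => /=.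
exact: (@scomm_of_jacobi K (supermx K n n) _ mulmx_linearl mulmx_linearr
          (@mulmxA _ _ _ _ _) (@mulmx_homog K n n) _ _ _ _ _ hx hy).
Qed.

HB.instance Definition _ := Superspace_isLieSuperalgebra.Build K periplectic
  periplectic_lie_linearl periplectic_lie_linearr periplectic_lie_homog
  periplectic_lie_skew periplectic_lie_jacobi.

End Periplectic.

(* The enveloping superalgebra U(g) is the quotient of the tensor algebra T(g)
   by the two-sided ideal generated by
     x (x) y - (-1)^(|x||y|) y (x) x - [x, y]   (x, y homogeneous).
   It is presented here as the unital K-algebra generated by the elements of g,
   subject to linearity and to these relations: noncommutative polynomial
   expressions modulo the least congruence making them such an algebra. *)
Inductive uexpr (K : numFieldType) (g : lieSuperalgType K) : Type :=
| UGen of g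
| UScal of K
| UAdd of uexpr g & uexpr g
| UMul of uexpr g & uexpr g.

Arguments UScal {K g} _.

Section EnvelopingRelation.
Variables (K : numFieldType) (g : lieSuperalgType K).
Implicit Types (s t u : uexpr g) (x y : g) (k l : K).

Inductive urel : uexpr g -> uexpr g -> Prop :=
| urel_refl t : urel t t
| urel_sym s t : urel s t -> urel t s
| urel_trans s t u : urel s t -> urel t u -> urel s u
| urel_add s s' t t' : urel s s' -> urel t t' -> urel (UAdd s t) (UAdd s' t')
| urel_mul s s' t t' : urel s s' -> urel t t' -> urel (UMul s t) (UMul s' t')
| urel_addA s t u : urel (UAdd s (UAdd t u)) (UAdd (UAdd s t) u)
| urel_addC s t : urel (UAdd s t) (UAdd t s)
| urel_add0 t : urel (UAdd (UScal 0) t) t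
| urel_mulA s t u : urel (UMul s (UMul t u)) (UMul (UMul s t) u)
| urel_mul1 t : urel (UMul (UScal 1) t) t
| urel_mul0 t : urel (UMul (UScal 0) t) (UScal 0)
| urel_mulDl s t u : urel (UMul (UAdd s t) u) (UAdd (UMul s u) (UMul t u))
| urel_mulDr s t u : urel (UMul s (UAdd t u)) (UAdd (UMul s t) (UMul s u))
| urel_scalD k l : urel (UScal (k + l)) (UAdd (UScal k) (UScal l))
| urel_scalM k l : urel (UScal (k * l)) (UMul (UScal k) (UScal l))
| urel_scalC k t : urel (UMul (UScal k) t) (UMul t (UScal k))
| urel_genD x y : urel (UGen (x + y)) (UAdd (UGen x) (UGen y))
| urel_genZ k x : urel (UGen (k *: x)) (UMul (UScal k) (UGen x))
| urel_lie a b x y : homog a x -> homog b y ->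
    urel (UMul (UGen x) (UGen y))
         (UAdd (UMul (UScal ((-1) ^+ (a && b))) (UMul (UGen y) (UGen x)))
               (UGen (lie x y))).

HB.instance Definition _ := gen_eqMixin (uexpr g).
HB.instance Definition _ := gen_choiceMixin (uexpr g).

Definition urelb : rel (uexpr g) := fun s t => `[< urel s t >].

Lemma urelb_refl : reflexive urelb.
Proof. by move=> t; apply/asboolP; apply: urel_refl. Qed.

Lemma urelb_sym : symmetric urelb.
Proof. by move=> s t; apply/asboolP/asboolP; apply: urel_sym. Qed.

Lemma urelb_trans : transitive urelb.
Proof.
move=> t s u /asboolP st /asboolP tu; apply/asboolP.
exact: urel_trans st tu.
Qed.

Canonical urel_equiv := EquivRel urelb urelb_refl urelb_sym urelb_trans.

End EnvelopingRelation.

Definition env (K : numFieldType) (g : lieSuperalgType K) :=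
  {eq_quot (urel_equiv g)}.

Section EnvelopingAlgebra.
Variables (K : numFieldType) (g : lieSuperalgType K).
Local Notation U := (env g).
Implicit Types (u v w : U) (s t : uexpr g) (x y : g) (k l : K) (a b : bool).

HB.instance Definition _ := Choice.on U.

Definition env_class t : U := (\pi_({eq_quot (urel_equiv g)}) t)%qT.
Local Notation cl := env_class.

Lemma env_classP s t : cl s = cl t <-> urel s t.
Proof.
rewrite /cl; split=> [/eqP|st]; last by apply/eqP; rewrite piE; apply/asboolP.
by rewrite piE => /asboolP.
Qed.

Lemma env_classE s t : urel s t -> cl s = cl t.
Proof. by move/env_classP. Qed.

Lemma env_ind (P : U -> Prop) : (forall t, P (cl t)) -> forall u, P u.
Proof. by move=> Pcl u; rewrite -[u]reprK. Qed.

Lemma urel_repr t : urel (repr (cl t)) t.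
Proof. by apply/env_classP; rewrite [LHS]reprK. Qed.

Definition env_add u v : U := cl (UAdd (repr u) (repr v)).
Definition env_mul u v : U := cl (UMul (repr u) (repr v)).
Definition env_scale k u : U := cl (UMul (UScal k) (repr u)).
Definition env_opp u : U := env_scale (- 1) u.

Lemma env_addE s t : env_add (cl s) (cl t) = cl (UAdd s t).
Proof. by apply/env_classE/urel_add; apply: urel_repr. Qed.
Lemma env_mulE s t : env_mul (cl s) (cl t) = cl (UMul s t).
Proof. by apply/env_classE/urel_mul; apply: urel_repr. Qed.
Lemma env_scaleE k t : env_scale k (cl t) = cl (UMul (UScal k) t).
Proof.
by apply/env_classE/urel_mul; [apply: urel_refl | apply: urel_repr].
Qed.

Let clE := (env_addE, env_mulE, env_scaleE).

Lemma env_addA : associative env_add.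
Proof.
elim/env_ind=> s; elim/env_ind=> t; elim/env_ind=> u.
by rewrite !clE; apply/env_classE/urel_addA.
Qed.
Lemma env_addC : commutative env_add.
Proof.
elim/env_ind=> s; elim/env_ind=> t.
by rewrite !clE; apply/env_classE/urel_addC.
Qed.
Lemma env_add0 : left_id (cl (UScal 0)) env_add.
Proof. by elim/env_ind=> s; rewrite !clE; apply/env_classE/urel_add0. Qed.
Lemma env_addN : left_inverse (cl (UScal 0)) env_opp env_add.
Proof.
elim/env_ind=> s; rewrite /env_opp -[X in env_add _ X](_ : cl (UMul (UScal 1) s) = _).
  rewrite !clE -(env_classE (urel_mulDl _ _ _)) -env_mulE.
  rewrite -(env_classE (urel_scalD _ _ _)) addNr env_mulE.
  exact/env_classE/urel_mul0.
exact/env_classE/urel_mul1.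
Qed.

HB.instance Definition _ :=
  GRing.isZmodule.Build U env_addA env_addC env_add0 env_addN.

Lemma env_mulA : associative env_mul.
Proof.
elim/env_ind=> s; elim/env_ind=> t; elim/env_ind=> u.
by rewrite !clE; apply/env_classE/urel_mulA.
Qed.
Lemma env_mul1 : left_id (cl (UScal 1)) env_mul.
Proof. by elim/env_ind=> s; rewrite !clE; apply/env_classE/urel_mul1. Qed.
Lemma env_mul1r : right_id (cl (UScal 1)) env_mul.
Proof.
elim/env_ind=> s; rewrite !clE -(env_classE (urel_scalC _ _)).
exact/env_classE/urel_mul1.
Qed.
Lemma env_mulDl : left_distributive env_mul env_add.
Proof.
elim/env_ind=> s; elim/env_ind=> t; elim/env_ind=> u.
by rewrite !clE; apply/env_classE/urel_mulDl.
Qed.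
Lemma env_mulDr : right_distributive env_mul env_add.
Proof.
elim/env_ind=> s; elim/env_ind=> t; elim/env_ind=> u.
by rewrite !clE; apply/env_classE/urel_mulDr.
Qed.

Fixpoint ueval (A : algType K) (f : g -> A) t : A :=
  match t with
  | UGen x => f x
  | UScal k => k%:A
  | UAdd s t => ueval f s + ueval f t
  | UMul s t => ueval f s * ueval f t
  end.

Definition lie_compatible (A : algType K) (f : g -> A) :=
  forall a b x y, homog a x -> homog b y ->
    f (lie x y) = f x * f y - (-1) ^+ (a && b) *: (f y * f x).

Lemma ueval_urel (A : algType K) (f : {linear g -> A}) :
  lie_compatible f -> forall s t, urel s t -> ueval f s = ueval f t.
Proof.
move=> fP s t; elim=> {s t} //=.
- by move=> s t u _ -> _ ->.
- by move=> s s' t t' _ -> _ ->.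
- by move=> s s' t t' _ -> _ ->.
- by move=> s t u; rewrite addrA.
- by move=> s t; rewrite addrC.
- by move=> t; rewrite scale0r add0r.
- by move=> s t u; rewrite mulrA.
- by move=> t; rewrite scale1r mul1r.
- by move=> t; rewrite scale0r mul0r.
- by move=> s t u; rewrite mulrDl.
- by move=> s t u; rewrite mulrDr.
- by move=> k l; rewrite scalerDl.
- by move=> k l; rewrite -scalerAl mul1r scalerA.
- by move=> k t; rewrite mulr_algl mulr_algr.
- by move=> x y; rewrite linearD.
- by move=> k x; rewrite linearZ mulr_algl.
- by move=> a b x y hx hy; rewrite (fP _ _ _ _ hx hy) mulr_algl addrC subrK.
Qed.

Lemma env_1_neq0 : cl (UScal 1) != cl (UScal 0).
Proof.
apply/eqP=> /env_classP /(@ueval_urel K^o \0).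
rewrite /= /GRing.scale /= mul0r mul1r => H.
have /eqP : (1 : K) = 0.
  by apply: H => a b x y _ _ /=; rewrite mulr0 scaler0 subr0.
by rewrite oner_eq0.
Qed.

HB.instance Definition _ := GRing.Zmodule_isNzRing.Build U
  env_mulA env_mul1 env_mul1r env_mulDl env_mulDr env_1_neq0.

Let clD s t : cl (UAdd s t) = cl s + cl t. Proof. by rewrite -env_addE. Qed.
Let clM s t : cl (UMul s t) = cl s * cl t. Proof. by rewrite -env_mulE. Qed.

Lemma env_scalZE k u : env_scale k u = cl (UScal k) * u.
Proof. by elim/env_ind: u => t; rewrite env_scaleE clM. Qed.

Lemma env_scalC k u : cl (UScal k) * u = u * cl (UScal k).
Proof.
by elim/env_ind: u => t; rewrite -!clM; apply/env_classE/urel_scalC.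
Qed.

Lemma env_scaleA k l u : env_scale k (env_scale l u) = env_scale (k * l) u.
Proof.
by rewrite !env_scalZE mulrA -clM -(env_classE (urel_scalM _ _ _)).
Qed.
Lemma env_scale1 : left_id 1 env_scale.
Proof. by move=> u; rewrite env_scalZE mul1r. Qed.
Lemma env_scaleDr : right_distributive env_scale +%R.
Proof. by move=> k u v; rewrite !env_scalZE mulrDr. Qed.
Lemma env_scaleDl u : {morph env_scale^~ u : k l / k + l}.
Proof.
by move=> k l; rewrite !env_scalZE (env_classE (urel_scalD _ _ _)) clD mulrDl.
Qed.

HB.instance Definition _ := GRing.Zmodule_isLmodule.Build K U
  env_scaleA env_scale1 env_scaleDr env_scaleDl.

Lemma env_scaleAl k u v : k *: (u * v) = (k *: u) * v.
Proof. by rewrite /GRing.scale /= !env_scalZE mulrA. Qed.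
HB.instance Definition _ := GRing.Lmodule_isLalgebra.Build K U env_scaleAl.

Lemma env_scaleAr k u v : k *: (u * v) = u * (k *: v).
Proof. by rewrite /GRing.scale /= !env_scalZE !mulrA env_scalC. Qed.
HB.instance Definition _ := GRing.Lalgebra_isAlgebra.Build K U env_scaleAr.

Lemma env_scalE k : cl (UScal k) = k%:A.
Proof. by rewrite /GRing.scale /= env_scalZE mulr1. Qed.

Definition iota x : U := cl (UGen x).

Lemma iota_linear : linear iota.
Proof.
move=> k x y; rewrite /iota (env_classE (urel_genD _ _)) clD.
by rewrite (env_classE (urel_genZ _ _)) clM env_scalE mulr_algl.
Qed.
HB.instance Definition _ := GRing.isLinear.Build K g U *:%R iota iota_linear.

Lemma iota_lie : lie_compatible iota.
Proof.
move=> a b x y hx hy.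
have := env_classE (urel_lie hx hy); rewrite clD !clM env_scalE mulr_algl.
by rewrite -!/(iota _) => ->; rewrite addrAC subrr add0r.
Qed.

Theorem env_universal (A : algType K) (f : {linear g -> A}) :
  lie_compatible f ->
  exists2 F : {lrmorphism U -> A}, F \o iota =1 f &
    forall F' : {lrmorphism U -> A}, F' \o iota =1 f -> F' =1 F.
Proof.
move=> fP; pose F u := ueval f (repr u).
have FE t : F (cl t) = ueval f t by apply: (ueval_urel fP (urel_repr t)).
have F_lin : linear F.
  move=> k; elim/env_ind=> s; elim/env_ind=> t.
  by rewrite -mulr_algl -env_scalE -clM -clD !FE /= mulr_algl.
have F_mul : GRing.monoid_morphism F.
  split=> [|]; first by rewrite -[1]/(cl (UScal 1)) FE /= scale1r.
  by elim/env_ind=> s; elim/env_ind=> t; rewrite -clM !FE.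
pose FL := GRing.isLinear.Build K U A *:%R F F_lin.
pose FM := GRing.isMonoidMorphism.Build U A F F_mul.
pose Fm : {lrmorphism U -> A} := HB.pack F FL FM.
exists Fm => [x|F' F'P]; first exact: FE.
elim/env_ind=> t; rewrite [RHS]FE; elim: t => [x|k|s IHs t IHt|s IHs t IHt] /=.
- exact: F'P.
- by rewrite env_scalE linearZ /= rmorph1.
- by rewrite clD rmorphD /= IHs IHt.
- by rewrite clM rmorphM /= IHs IHt.
Qed.

(* Parity projections of U(g), for the Z/2-grading in which the image of g_b
   is of parity b. *)
Fixpoint uexpr_hpart b t : U :=
  match t with
  | UGen x => iota (hpart b x)
  | UScal k => if b then 0 else k%:A
  | UAdd s t => uexpr_hpart b s + uexpr_hpart b t
  | UMul s t => uexpr_hpart false s * uexpr_hpart b t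
                + uexpr_hpart true s * uexpr_hpart (~~ b) t
  end.

Lemma uexpr_hpart_urel s t : urel s t ->
  forall b, uexpr_hpart b s = uexpr_hpart b t.
Proof.
elim=> {s t} //=.
- by move=> s t u _ H _ H' b; rewrite H H'.
- by move=> s s' t t' _ H _ H' b; rewrite H H'.
- by move=> s s' t t' _ H _ H' b; rewrite !H !H'.
- by move=> s t u b; rewrite addrA.
- by move=> s t b; rewrite addrC.
- by move=> t b; case: b; rewrite ?scale0r add0r.
- move=> s t u b; rewrite negbK !mulrDr !mulrDl !mulrA -!addrA; congr (_ + _).
  by rewrite [RHS]addrC -!addrA; congr (_ + _); rewrite addrC.
- by move=> t b; rewrite scale1r mul1r mul0r addr0.
- by move=> t b; rewrite scale0r !mul0r addr0; case: b.
- by move=> s t u b; rewrite !mulrDl addrACA.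
- by move=> s t u b; rewrite !mulrDr addrACA.
- by move=> k l b; case: b; rewrite ?addr0 ?scalerDl.
- by move=> k l b; case: b => /=; rewrite ?mulr0 ?mul0r ?addr0 //
    -scalerAl mul1r scalerA.
- by move=> k t b; case: b => /=; rewrite mul0r ?mulr0 ?addr0 ?add0r
    mulr_algl mulr_algr.
- by move=> x y b; rewrite !linearD.
- by move=> k x b; rewrite mul0r addr0 !linearZ mulr_algl.
- move=> a b x y hx hy c.
  rewrite !(homogE _ hx) !(homogE _ hy) (homogE _ (lie_homog _ _ _ _ hx hy)).
  have L := iota_lie hx hy.
  case: a b c hx hy L => [] [] [] /= hx hy L;
    rewrite ?linear0 ?L ?(mul0r, mulr0, addr0, add0r, mulr_algl, scaler0) //;
    by rewrite addrC subrK.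
Qed.

Definition env_hpart b u : U := uexpr_hpart b (repr u).

Lemma env_hpartE b t : env_hpart b (cl t) = uexpr_hpart b t.
Proof. exact: uexpr_hpart_urel (urel_repr t) b. Qed.

Lemma env_hpart_iota b x : env_hpart b (iota x) = iota (hpart b x).
Proof. exact: env_hpartE. Qed.

Lemma env_hpart1 b : env_hpart b 1 = if b then 0 else 1.
Proof. by rewrite -[X in env_hpart _ X]/(cl (UScal 1)) env_hpartE /= scale1r. Qed.

Lemma env_hpartM b u v : env_hpart b (u * v) =
  env_hpart false u * env_hpart b v + env_hpart true u * env_hpart (~~ b) v.
Proof.
by elim/env_ind: u => s; elim/env_ind: v => t; rewrite -clM !env_hpartE.
Qed.

Lemma env_hpart_linear b : linear (env_hpart b).
Proof.
move=> k; elim/env_ind=> s; elim/env_ind=> t.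
rewrite -mulr_algl -env_scalE -clM -clD !env_hpartE /=.
by rewrite mul0r addr0 mulr_algl.
Qed.

Lemma env_hpart_sum u : env_hpart false u + env_hpart true u = u.
Proof.
elim/env_ind: u; elim=> [x|k|s IHs t IHt|s IHs t IHt].
- by rewrite -/(iota x) !env_hpart_iota -linearD hpart_sum.
- by rewrite !env_hpartE /= addr0 env_scalE.
- by rewrite !env_hpartE /= addrACA -!env_hpartE IHs IHt clD.
- rewrite clM !env_hpartM /= -[in RHS]IHs -[in RHS]IHt mulrDl !mulrDr -!addrA.
  by congr (_ + _); rewrite addrC -!addrA; congr (_ + _); rewrite addrC.
Qed.

Lemma env_hpart_idem a b u :
  env_hpart a (env_hpart b u) = if a == b then env_hpart b u else 0.
Proof.
have hp0 c : env_hpart c 0 = 0.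
  have := env_hpart_linear c (-1) 0 0.
  by rewrite !scaleN1r !addNr.
have hpD c v w : env_hpart c (v + w) = env_hpart c v + env_hpart c w.
  by have := env_hpart_linear c 1 v w; rewrite !scale1r.
elim/env_ind: u => t; elim: t a b => [x|k|s IHs t IHt|s IHs t IHt] a b.
- rewrite -/(iota x) !env_hpart_iota hpart_idem.
  by case: eqP => //; rewrite linear0.
- rewrite !env_hpartE /= -env_scalE; case: b; case: a;
    by rewrite ?hp0 ?env_hpartE //= -env_scalE.
- by rewrite clD !hpD IHs IHt; case: eqP => //; rewrite addr0.
- rewrite clM !env_hpartM hpD !env_hpartM !IHs !IHt.
  by case: a; case: b => /=; rewrite ?(mul0r, mulr0, addr0, add0r).
Qed.

HB.instance Definition _ := Lmodule_isSuperspace.Build K U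
  env_hpart_linear env_hpart_sum env_hpart_idem.

Lemma hpart_iota b x : hpart b (iota x) = iota (hpart b x).
Proof. exact: env_hpart_iota. Qed.

Lemma env_homog_one : homog false (1 : U).
Proof. exact: env_hpart1. Qed.

Lemma env_homog_mul a b u v :
  homog a u -> homog b v -> homog (a (+) b) (u * v).
Proof.
move=> hu hv; rewrite /homog [LHS]env_hpartM -!/(hpart _ _).
rewrite !(homogE _ hu) !(homogE _ hv).
by case: a {hu}; case: b {hv} => /=; rewrite ?(mul0r, mulr0, addr0, add0r).
Qed.

HB.instance Definition _ := Algebra_isSuperalgebra.Build K U
  env_homog_one env_homog_mul.

Lemma scomm_iota x y : scomm (iota x) (iota y) = iota (lie x y).
Proof.
transitivity (iota (lie (hpart true x + hpart false x)
                        (hpart true y + hpart false y))); last first.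
  by rewrite ![hpart true _ + _]addrC !hpart_sum.
have lieDl (u v w : g) : lie (u + v) w = lie u w + lie v w.
  by have := lie_linearl w 1 u v; rewrite !scale1r.
have lieDr (w u v : g) : lie w (u + v) = lie w u + lie w v.
  by have := lie_linearr w 1 u v; rewrite !scale1r.
rewrite lieDl !lieDr !linearD /scomm /scomm_of !big_bool /= !hpart_iota.
by rewrite !(iota_lie (homog_hpart _ x) (homog_hpart _ y)).
Qed.

End EnvelopingAlgebra.

(* The elements annihilated by the adjoint action z |-> [iota x, z] of g. *)
Definition supercenter (K : numFieldType) (g : lieSuperalgType K) :
    set (env g) :=
  [set z | forall x : g, scomm (iota x) z = 0].

Arguments supercenter {K} g.

(* Main.v *)
Require Import Defs.
From HB Require Import structures.
From mathcomp Require Import all_boot all_order all_algebra.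
From mathcomp Require Import classical_sets reals complex ring zify.

(* Comultiplication followed by the defining representation of g on C^(n|n)
   turns each matrix entry x |-> x_ij into an operator on U(g) which kills the
   constants and, modulo lower order terms, is the superderivation extending
   this functional.  These partial derivatives replace the PBW theorem: an
   element z of order d has order < d as soon as all scalars D_p1 ... D_pd z
   vanish.  If z is invariant, these scalars are the values of an invariant
   supersymmetric d-linear form on the dual of g, which is shown to vanish by
   induction on the number of off-diagonal arguments.
   - If all arguments are diagonal, use the root vector of 2 eps_i: since
     -2 eps_i is not a root, its action produces only the diagonal argument
     eps_i out of the argument dual to it.
   - An off-diagonal argument of weight alpha such that -alpha is a root is
     removed with a root vector of weight -alpha, since [g_alpha, g_-alpha] is
     a nonzero line in the Cartan subalgebra.
   - The only other off-diagonal arguments have weights 2 eps_i, and the form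
     vanishes on them because diag(1, -1) acts by a nonzero scalar.
   So z has order 0, i.e., it is a scalar. *)

Set Implicit Arguments.
Unset Strict Implicit.
Unset Printing Implicit Defensive.

Import GRing.Theory Num.Theory.

Local Open Scope classical_set_scope.
Local Open Scope ring_scope.

(* [iota] is also the integer interval of [seq]. *)
Local Notation inj := (@Defs.iota _ _).

(** * The standard filtration of U(g) *)

Section Filtration.
Variables (K : numFieldType) (g : lieSuperalgType K).
Local Notation U := (env g).
Implicit Types (u v w : U) (x y : g) (a b : bool) (r k : nat).

Definition ad x : U -> U := scomm (inj x).

Lemma ad_linear x : linear (ad x).
Proof.
by apply: scomm_of_linearr => [w k u v|w k u v];
  rewrite (mulrDl, mulrDr) -(scalerAl, scalerAr).
Qed.
HB.instance Definition _ x := GRing.isLinear.Build K U U *:%R (ad x) (ad_linear x).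

Lemma homog_inj b x : homog b x -> homog b (inj x).
Proof. by rewrite /homog hpart_iota => ->. Qed.

Lemma adDl x y u : ad (x + y) u = ad x u + ad y u.
Proof.
rewrite /ad linearD /=.
have := @scomm_of_linearl K U *%R _ _ u 1 (inj x) (inj y).
rewrite !scale1r; apply=> w k v v';
  by rewrite (mulrDl, mulrDr) -(scalerAl, scalerAr).
Qed.

Lemma ad1 x : ad x 1 = 0.
Proof.
have E b : ad (hpart b x) 1 = 0.
  rewrite /ad (scommE (homog_inj (homog_hpart b x)) homog_one).
  by rewrite andbF expr0 scale1r mulr1 mul1r subrr.
by rewrite -(hpart_sum x) adDl !E addr0.
Qed.

Lemma ad_mul a b x y u : homog a x -> homog b y ->
  ad x (inj y * u) = inj (lie x y) * u + (-1) ^+ (a && b) *: (inj y * ad x u).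
Proof.
move=> hx hy; rewrite -(hpart_sum u) mulrDr !linearD /= !mulrDr !scalerDr.
rewrite addrACA; congr (_ + _); have [hix hiy] := (homog_inj hx, homog_inj hy).
all: set c := (X in hpart X _); set w := hpart c u;
  have hw : homog c w by apply: homog_hpart.
all: rewrite /ad (scommE hix (homog_mul _ _ _ _ hiy hw)) (scommE hix hw).
all: rewrite (iota_lie hx hy) mulrBl mulrBr scalerBr -!scalerAl -!scalerAr !mulrA.
all: by rewrite subrKA scalerA; congr (_ - _ *: _); clear;
  case: a; case: b; rewrite /c /= ?expr0 ?expr1 ?mulr1 ?mul1r ?mulrNN ?mulr1.
Qed.

Lemma ad_scale x (c : K) : ad x c%:A = 0.
Proof. by rewrite linearZ /= ad1 scaler0. Qed.

(* Shifted by one so that the junk level [Fil 0] is zero: [Fil r.+1] is spanned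
   by the products of at most [r] elements of [g]. *)
Inductive Fil : nat -> U -> Prop :=
| Fil_zero r : Fil r 0
| Fil_one r : Fil r.+1 1
| Fil_lin r (k : K) u v : Fil r u -> Fil r v -> Fil r (k *: u + v)
| Fil_mul r b x u : homog b x -> Fil r u -> Fil r.+1 (inj x * u).

Lemma FilZ r (k : K) u : Fil r u -> Fil r (k *: u).
Proof. by move=> Fu; rewrite -[_ *: _]addr0; apply: Fil_lin => //; apply: Fil_zero. Qed.
Lemma FilD r u v : Fil r u -> Fil r v -> Fil r (u + v).
Proof. by move=> Fu Fv; rewrite -[u]scale1r; apply: Fil_lin. Qed.
Lemma FilN r u : Fil r u -> Fil r (- u).
Proof. by rewrite -scaleN1r; apply: FilZ. Qed.
Lemma FilB r u v : Fil r u -> Fil r v -> Fil r (u - v).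
Proof. by move=> Fu /FilN; apply: FilD. Qed.
Lemma Fil_sum r (I : Type) (s : seq I) (P : pred I) (f : I -> U) :
  (forall i, P i -> Fil r (f i)) -> Fil r (\sum_(i <- s | P i) f i).
Proof.
by move=> Ff; elim/big_ind: _ => //; [apply: Fil_zero | apply: FilD].
Qed.

Lemma Fil_mulg r x u : Fil r u -> Fil r.+1 (inj x * u).
Proof.
by move=> Fu; rewrite -(hpart_sum x) linearD mulrDl;
  apply: FilD; apply: Fil_mul Fu; apply: homog_hpart.
Qed.

Lemma FilS r u : Fil r u -> Fil r.+1 u.
Proof.
elim=> {r u} [r|r|r k u v _ Fu _ Fv|r b x u hx _ Fu]; by
  [apply: Fil_zero|apply: Fil_one|apply: Fil_lin|apply: Fil_mul hx _].
Qed.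

Lemma Fil_le r k u : (r <= k)%N -> Fil r u -> Fil k u.
Proof.
by move=> /subnKC <-; elim: (k - r)%N => [|m IH] Fu; rewrite ?addn0 ?addnS //;
  apply/FilS/IH.
Qed.

Lemma Fil0 u : Fil 0 u -> u = 0.
Proof.
move=> Fu; suff: forall r w, Fil r w -> r = 0%N -> w = 0 by move/(_ _ _ Fu erefl).
move=> r w; elim=> {u Fu r w} // r k u v _ IHu _ IHv r0.
by rewrite IHu // IHv // scaler0 addr0.
Qed.

Lemma Fil1 u : Fil 1 u -> exists k : K, u = k%:A.
Proof.
move=> Fu; suff: forall r w, Fil r w -> r = 1%N -> exists k : K, w = k%:A.
  by move/(_ _ _ Fu erefl).
move=> r w; elim=> {r w Fu} [r|r|r k v w _ IHv _ IHw|r b x w hx Fw _] r1.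
- by exists 0; rewrite scale0r.
- by exists 1; rewrite scale1r.
- have [[c ->] [c' ->]] := (IHv r1, IHw r1).
  by exists (k * c + c'); rewrite scalerDl scalerA.
- by case: r1 Fw => -> /Fil0 ->; exists 0; rewrite mulr0 scale0r.
Qed.

Lemma Fil_mulg_sub r k u x : Fil (r - k) u -> Fil (r.+1 - k) (inj x * u).
Proof.
have [kr|kr] := leqP k r; first by rewrite subSn //; apply: Fil_mulg.
have /eqP -> : (r - k == 0)%N by rewrite subn_eq0 ltnW.
by move/Fil0->; rewrite mulr0; apply: Fil_zero.
Qed.

(** Owing to the shift, the level [r + k] is one above the sharp one; it suffices to show that the
    filtration is exhaustive. *)
Lemma Fil_mul2 r k u v : Fil r u -> Fil k v -> Fil (r + k) (u * v).
Proof.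
move=> Fu Fv; elim: Fu => {r u} [r|r|r c u w _ IHu _ IHw|r b x u hx _ IHu].
- by rewrite mul0r; apply: Fil_zero.
- by rewrite mul1r; apply: Fil_le Fv; apply: leq_addl.
- by rewrite mulrDl -scalerAl; apply: Fil_lin.
- by rewrite -mulrA; apply: Fil_mul hx IHu.
Qed.

Lemma Fil_exists u : exists r, Fil r u.
Proof.
elim/env_ind: u; elim=> [x|k|s [r Fs] t [q Ft]|s [r Fs] t [q Ft]].
- exists 2; rewrite -/(inj x) -[inj x]mulr1; exact/Fil_mulg/Fil_one.
- by exists 1%N; rewrite env_scalE; apply/FilZ/Fil_one.
- exists (r + q)%N; rewrite -env_addE; apply: FilD.
    by apply: Fil_le Fs; apply: leq_addr.
  by apply: Fil_le Ft; apply: leq_addl.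
- by exists (r + q)%N; rewrite -env_mulE; apply: Fil_mul2.
Qed.

(** The common induction for operators lowering the filtration by [k]. Truncated subtraction is
    harmless, since level 0 is zero; [T 1 = 0] is the base case. *)
Lemma Fil_lower k (T : U -> U) : linear T -> T 1 = 0 ->
  (forall r b y u, homog b y -> Fil r u -> Fil (r - k) (T u) ->
     Fil (r.+1 - k) (T (inj y * u))) ->
  forall r u, Fil r u -> Fil (r - k) (T u).
Proof.
move=> Tlin T1 TM r u; elim=> {r u} [r|r|r c u v _ IHu _ IHv|r b x u hx Fu IHu].
- by have := Tlin (-1) 0 0; rewrite !scaleN1r !addNr => ->; apply: Fil_zero.
- by rewrite T1; apply: Fil_zero.
- by rewrite Tlin; apply: Fil_lin.
- exact: TM hx Fu IHu.
Qed.

(** By [ad_mul], a bracket replaces one factor of a product by another element of [g], so products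
    do not get longer. *)
Lemma Fil_ad r x u : Fil r u -> Fil r (ad x u).
Proof.
have aux a q v : Fil q v -> Fil (q - 0) (ad (hpart a x) v).
  move: q v; apply: (@Fil_lower 0 (ad (hpart a x)) (ad_linear _)); first exact: ad1.
  move=> q b y v hy Fv; rewrite !subn0 => Fa.
  rewrite (ad_mul _ (homog_hpart _ x) hy).
  by apply: FilD; [apply: Fil_mulg|apply/FilZ/Fil_mulg].
by rewrite -(hpart_sum x) adDl => Fu; apply: FilD; rewrite -[r]subn0; apply: aux.
Qed.
End Filtration.

(** * Partial derivatives *)

Section MatrixCoefficients.
Variables (K : numFieldType) (n : nat).
Local Notation g := (periplectic K n).
Local Notation U := (env g).
Local Notation N := (n + n)%N.
Implicit Types (u v w : U) (x y : g) (a b e : bool) (i j k : 'I_N).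

Definition par (i : 'I_N) : bool := (n <= i)%N.

Lemma par_lshift (i : 'I_n) : par (lshift n i) = false.
Proof. by apply/negbTE; rewrite -ltnNge /=. Qed.
Lemma par_rshift (i : 'I_n) : par (rshift n i) = true.
Proof. by rewrite /par /= leq_addr. Qed.

Lemma homog_entry a x i j : homog a x -> par i (+) par j != a -> x i j = 0.
Proof.
move=> hx; have -> : periplectic_mx x = mx_hpart a x by rewrite -[in LHS]hx.
rewrite /mx_hpart -(splitK i) -(splitK j).
case: (split i) => i'; case: (split j) => j' /=;
  rewrite ?par_lshift ?par_rshift; case: a {hx} => //= _;
  by rewrite (block_mxEul, block_mxEur, block_mxEdl, block_mxEdr) mxE.
Qed.

Lemma sign_entry a b x i j : homog a x ->
  (-1) ^+ (b && a) * x i j = (-1) ^+ (b && (par i (+) par j)) * x i j.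
Proof.
move=> hx; have [->//|ne] := eqVneq (par i (+) par j) a.
by rewrite (homog_entry hx ne) !mulr0.
Qed.

Definition coact_gen e x : 'M[U]_N :=
  diag_mx (\row_i (inj (hpart false x) + (-1) ^+ (par i (+) e) *: inj (hpart true x)))
  + map_mx (in_alg U) x.

Fixpoint coact_expr e (t : uexpr g) : 'M[U]_N :=
  match t with
  | UGen x => coact_gen e x
  | UScal c => (c%:A)%:M
  | UAdd s t => coact_expr e s + coact_expr e t
  | UMul s t => coact_expr e s *m coact_expr e t
  end.

Lemma coact_genE e a x : homog a x -> coact_gen e x =
  diag_mx (\row_i ((-1) ^+ ((par i (+) e) && a) *: inj x)) + map_mx (in_alg U) x.
Proof.
move=> hx; congr (diag_mx _ + _); apply/rowP=> i; rewrite !mxE !(homogE _ hx).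
by case: a {hx}; rewrite /= linear0 ?add0r ?scaler0 ?addr0 ?andbT ?andbF ?expr0 ?scale1r.
Qed.

Lemma coact_gen_linear e c x y : coact_gen e (c *: x + y) = c%:A%:M *m coact_gen e x + coact_gen e y.
Proof.
rewrite /coact_gen mul_scalar_mx; apply/matrixP=> i j.
rewrite !mxE /= !linearP /= scalerDl -scalerA mulr_algl.
case: eqP => _; rewrite ?mulr1n ?mulr0n ?add0r //.
by rewrite !scalerDr [RHS]addrACA; congr (_ + _); rewrite addrACA.
Qed.

Lemma lie_mx a b x y : homog a x -> homog b y ->
  periplectic_mx (lie x y) = (x : 'M_N) *m y - (-1) ^+ (a && b) *: ((y : 'M_N) *m x).
Proof.
move=> /periplectic_homog hx /periplectic_homog hy.
rewrite -[LHS]/(mx_scomm x y) /mx_scomm (scomm_ofE _ _ hx hy) // => [M|M] c A B.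
  by rewrite mulmxDl scalemxAl.
by rewrite mulmxDr scalemxAr.
Qed.

Lemma coact_gen_entry e a x i j : homog a x -> coact_gen e x i j =
  (if i == j then (-1) ^+ ((par i (+) e) && a) *: inj x else 0) + (x i j)%:A.
Proof. by move=> hx; rewrite (coact_genE e hx) !mxE; case: eqP. Qed.

Lemma mulmx_coact_gen e a x (m : nat) (M : 'M[U]_(N, m)) i (j : 'I_m) : homog a x ->
  (coact_gen e x *m M) i j = (-1) ^+ ((par i (+) e) && a) *: (inj x * M i j)
    + \sum_k x i k *: M k j.
Proof.
move=> hx; rewrite (coact_genE e hx) mulmxDl mul_diag_mx !mxE -scalerAl.
by congr (_ + _); apply: eq_bigr => k _; rewrite !mxE /= mulr_algl.
Qed.

(** This is the defining relation of U(g), which makes [coact] well defined. The mixed terms cancel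
    because conjugation by the sign matrix multiplies [x] by its parity sign. *)
Lemma coact_gen_lie e a b x y : homog a x -> homog b y ->
  coact_gen e x *m coact_gen e y =
    ((-1) ^+ (a && b))%:A%:M *m (coact_gen e y *m coact_gen e x) + coact_gen e (lie x y).
Proof.
move=> hx hy; apply/matrixP=> i j.
(* Four terms: the product of the diagonal parts, two mixed terms, and the product of the scalar
   matrices. *)
have prod c d (u v : g) : homog c u -> homog d v -> (coact_gen e u *m coact_gen e v) i j =
   (if i == j then (-1) ^+ ((par i (+) e) && (c (+) d)) *: (inj u * inj v) else 0)
   + ((-1) ^+ ((par i (+) e) && c) * v i j) *: inj u
   + ((-1) ^+ ((par j (+) e) && d) * u i j) *: inj v
   + (((u : 'M_N) *m v) i j)%:A.
  move=> hu hv; rewrite (mulmx_coact_gen _ _ _ _ hu) (coact_gen_entry e _ _ hv).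
  under eq_bigr => k _ do rewrite (coact_gen_entry e _ _ hv) scalerDr.
  rewrite big_split /= mulrDr scalerDr -!addrA; congr (_ + (_ + (_ + _))).
  - case: eqP => _; last by rewrite mulr0 scaler0.
    by rewrite -scalerAr scalerA andb_addr signr_addb.
  - by rewrite mulr_algr scalerA.
  - rewrite (bigD1 j) //= eqxx big1 ?addr0 => [|k /negbTE ->]; last by rewrite scaler0.
    by rewrite scalerA mulrC.
  - by rewrite mxE scaler_suml; apply: eq_bigr => k _; rewrite scalerA.
rewrite mul_scalar_mx [RHS]mxE [X in _ = X + _]mxE mulr_algl.
rewrite (prod _ _ _ _ hx hy) (prod _ _ _ _ hy hx).
rewrite (coact_gen_entry e _ _ (lie_homog _ _ _ _ hx hy)) (lie_mx hx hy).
have zid (A : zmodType) (d2 d3 p q m1 m2 : A) :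
    d2 + d3 + q + p + m1 = d2 + p + q + m2 + (d3 + (m1 - m2)).
  rewrite [RHS]addrACA [m2 + _]addrC subrK; congr (_ + _).
  by rewrite -!addrA; congr (_ + _); rewrite addrC [q + p]addrC -addrA.
rewrite !scalerDr !scalerA mulrA mulrA.
have -> : ((x : 'M_N) *m y - (-1) ^+ (a && b) *: ((y : 'M_N) *m x)) i j
   = ((x : 'M_N) *m y) i j - (-1) ^+ (a && b) * ((y : 'M_N) *m x) i j.
  by rewrite [LHS]mxE [X in _ + X]mxE [X in - X]mxE.
rewrite scalerBl -zid; congr (_ + _ *: _ + _ *: _ + _).
- case: eqP => _; last by rewrite scaler0 addr0.
  rewrite (iota_lie hx hy) scalerBr !scalerA [b (+) a]addbC addrC.
  by rewrite [X in - (X *: _)]mulrC subrK.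
(* A nonzero entry determines the parity of [y], so finitely many signs remain to be compared. *)
- have [<-|ne] := eqVneq (par i (+) par j) b; last by rewrite (homog_entry hy ne) !mulr0.
  congr (_ * _); clear; case: a; case: e; case: (par i); case: (par j);
  by rewrite /= ?expr0 ?expr1 ?mulr1 ?mul1r ?mulrNN ?mulr1.
- have [<-|ne] := eqVneq (par i (+) par j) a; last by rewrite (homog_entry hx ne) !mulr0.
  congr (_ * _); clear; case: b; case: e; case: (par i); case: (par j);
  by rewrite /= ?expr0 ?expr1 ?mulr1 ?mul1r ?mulrNN ?mulr1.
Qed.

Lemma coact_genD e x y : coact_gen e (x + y) = coact_gen e x + coact_gen e y.
Proof. by have := coact_gen_linear e 1 x y; rewrite !scale1r mul_scalar_mx scale1r. Qed.

Lemma coact_genZ e c x : coact_gen e (c *: x) = c%:A%:M *m coact_gen e x.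
Proof.
have E0 : coact_gen e 0 = 0.
  by apply: (@addrI _ (coact_gen e 0)); rewrite -coact_genD !addr0.
by have := coact_gen_linear e c x 0; rewrite E0 !addr0.
Qed.

Lemma coact_expr_urel e s t : urel s t -> coact_expr e s = coact_expr e t.
Proof.
have scalC (c : K) (M : 'M[U]_N) : (c%:A)%:M *m M = M *m (c%:A)%:M.
  rewrite -!diag_const_mx; apply/matrixP=> i j.
  by rewrite mul_diag_mx mul_mx_diag !mxE mulr_algl mulr_algr.
elim=> {s t} //=.
- by move=> s t u _ -> _ ->.
- by move=> s s' t t' _ -> _ ->.
- by move=> s s' t t' _ -> _ ->.
- by move=> s t u; rewrite addrA.
- by move=> s t; rewrite addrC.
- by move=> t; rewrite scale0r raddf0 add0r.
- by move=> s t u; rewrite mulmxA.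
- by move=> t; rewrite scale1r mul1mx.
- by move=> t; rewrite scale0r raddf0 mul0mx.
- by move=> s t u; rewrite mulmxDl.
- by move=> s t u; rewrite mulmxDr.
- by move=> k l; rewrite scalerDl raddfD.
- by move=> k l; rewrite -scalar_mxM mulr_algl scalerA.
- by move=> x y; rewrite coact_genD.
- by move=> k x; rewrite coact_genZ.
- by move=> a b x y hx hy; rewrite (coact_gen_lie e hx hy).
Qed.

(* Comultiplication of U(g) followed by the defining representation in the
   second factor, x |-> x (x) diag(1, -1)^|x| + 1 (x) x; the flag [e] replaces
   diag(1, -1) by the equally legitimate diag(-1, 1). *)
Definition coact e u : 'M[U]_N := coact_expr e (repr u).
Local Notation F := coact.

Lemma coactE e t : F e (env_class t) = coact_expr e t.
Proof. exact: coact_expr_urel (urel_repr t). Qed.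

Lemma coact1 e : F e 1 = 1%:M.
Proof. by rewrite -[1]/(env_class (UScal 1)) coactE /= scale1r. Qed.

Lemma coact_mul e x u : F e (inj x * u) = coact_gen e x *m F e u.
Proof.
elim/env_ind: u => t.
by rewrite -[X in F _ X]/(env_mul _ _) env_mulE !coactE.
Qed.

Lemma coact_linear e c u v : F e (c *: u + v) = c%:A%:M *m F e u + F e v.
Proof.
elim/env_ind: u => s; elim/env_ind: v => t.
by rewrite -[X in F _ X]/(env_add (env_scale _ _) _) env_scaleE env_addE !coactE.
Qed.

(* With the flag [par j] the sign in column [j] is trivial, so that the one in
   row [i] is the Koszul sign of the functional [x |-> x i j].  Locked, as
   rewriting with [linearD] would otherwise see through the subtraction. *)
Definition D : 'I_N -> 'I_N -> U -> U :=
  locked (fun i j u => F (par j) u i j - (i == j)%:R * u).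

Lemma DE i j u : D i j u = F (par j) u i j - (i == j)%:R * u.
Proof. by rewrite /D -lock. Qed.

Lemma D_linear i j : linear (D i j).
Proof.
move=> c u v; rewrite !DE coact_linear mul_scalar_mx !mxE mulr_algl.
by rewrite mulrDr scalerBr opprD addrACA scalerAr.
Qed.
HB.instance Definition _ i j := GRing.isLinear.Build K U U *:%R (D i j) (D_linear i j).

Lemma DD i j u v : D i j (u + v) = D i j u + D i j v.
Proof. exact: linearD. Qed.
Lemma DZ i j c u : D i j (c *: u) = c *: D i j u.
Proof. exact: linearZ. Qed.

Lemma D1 i j : D i j 1 = 0.
Proof. by rewrite DE coact1 !mxE mulr1 subrr. Qed.

(** The first term comes from [x] in the first tensor factor, the others from the second;
    subtracting [(i == j)%:R * u] in [D] splits off [x i j *: u]. *)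
Lemma D_mul a x i j u : homog a x -> D i j (inj x * u) =
  (-1) ^+ (a && (par i (+) par j)) *: (inj x * D i j u)
  + x i j *: u + \sum_k x i k *: D k j u.
Proof.
move=> hx; have -> : \sum_k x i k *: D k j u = \sum_k x i k *: F (par j) u k j - x i j *: u.
  rewrite (bigD1 j) // [in RHS](bigD1 j) //= addrAC -scalerBr.
  rewrite {1}DE eqxx mul1r; congr (_ + _); apply: eq_bigr => k /negbTE kj.
  by rewrite DE kj mul0r subr0.
rewrite !DE coact_mul (mulmx_coact_gen _ _ _ _ hx) andbC -[RHS]addrA [X in _ = _ + X]addrC subrK.
rewrite mulrBr scalerBr addrAC; congr (_ - _ + _).
have [->|_] := eqVneq i j; first by rewrite addbb andbF expr0 scale1r !mul1r.
by rewrite !mul0r mulr0 scaler0.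
Qed.

End MatrixCoefficients.

(** * Calculus of the partial derivatives modulo lower order *)

Section Derivations.
Variables (K : numFieldType) (n : nat).
Local Notation g := (periplectic K n).
Local Notation U := (env g).
Local Notation N := (n + n)%N.
Implicit Types (u v w : U) (x y : g) (a b e : bool) (i j k l : 'I_N) (r : nat).

Lemma Fil_D r i j u : Fil r u -> Fil (r - 1) (D i j u).
Proof.
move=> Fu; elim: Fu i j => {r u} [r|r|r c u v _ IHu _ IHv|r b x u hx Fu IHu] i j.
- by rewrite linear0; apply: Fil_zero.
- by rewrite D1; apply: Fil_zero.
- by rewrite linearP; apply: Fil_lin; [apply: IHu|apply: IHv].
- rewrite (D_mul _ _ _ hx); apply: FilD; first apply: FilD.
  + by apply/FilZ/Fil_mulg_sub.
  + by rewrite subn1; apply: FilZ.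
  + by apply: Fil_sum => k _; apply/FilZ; apply: Fil_le (IHu k j); rewrite leq_sub2r.
Qed.

(** The sum in [D_mul] has lower order, so [D i j] acts as the superderivation sending [x] to
    [x i j]. *)
Lemma D_mul_mod a r x i j u : homog a x -> Fil r u ->
  exists2 w, Fil (r - 1) w & D i j (inj x * u) =
  (-1) ^+ (a && (par i (+) par j)) *: (inj x * D i j u) + x i j *: u + w.
Proof.
move=> hx Fu; eexists; last exact: D_mul.
by apply: Fil_sum => k _; apply/FilZ/Fil_D.
Qed.

Lemma entry_sign a b x i j : homog a x ->
  (-1) ^+ (a && b) * x i j = (-1) ^+ ((par i (+) par j) && b) * x i j.
Proof. by move=> hx; rewrite andbC (sign_entry _ _ _ hx) andbC. Qed.

(** Up to lower order, the supercommutator of two superderivations is one again, and it kills the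
    generators because their derivatives are scalars. So it lowers the filtration by three levels
    instead of two. *)
Lemma D_swap r i j k l u : Fil r u ->
  Fil (r - 3) (D i j (D k l u)
     - (-1) ^+ ((par i (+) par j) && (par k (+) par l)) *: D k l (D i j u)).
Proof.
have step a q y i' j' k' l' v : homog a y -> Fil q v ->
    exists2 w, Fil (q - 2) w & D i' j' (D k' l' (inj y * v)) =
    ((-1) ^+ (a && (par i' (+) par j')) * (-1) ^+ (a && (par k' (+) par l')))
       *: (inj y * D i' j' (D k' l' v))
    + ((-1) ^+ ((par i' (+) par j') && (par k' (+) par l')) * y i' j') *: D k' l' v
    + y k' l' *: D i' j' v + w.
  move=> hy Fv; have [w1 Fw1 ->] := D_mul_mod k' l' hy Fv.
  have [w2 Fw2 E] := D_mul_mod i' j' hy (Fil_D k' l' Fv).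
  exists ((-1) ^+ (a && (par k' (+) par l')) *: w2 + D i' j' w1).
    rewrite -(subnDA 1 q 1) in Fw2; apply: FilD; first exact: FilZ.
    by rewrite (subnDA 1 q 1); apply: Fil_D.
  rewrite !DD !DZ /= E !scalerDr !scalerA (entry_sign _ _ _ hy).
  by rewrite [_ ^+ (a && (par k' (+) _)) * _]mulrC addrA; congr (_ + _); rewrite addrAC.
set s := (-1) ^+ _; move: r u.
pose T := (D i j \o D k l \- (s \*: (D k l \o D i j))).
apply: (@Fil_lower _ _ 3 T (linearP _)); rewrite /T /=.
  by rewrite !D1 !linear0 addr0.
move=> r a y u hy Fu IH.
have [w1 Fw1 ->] := step _ _ _ i j k l _ hy Fu.
have [w2 Fw2 ->] := step _ _ _ k l i j _ hy Fu.
(* The cross terms [p] and [q] cancel; [d - d'] is [y] times the supercommutator applied to [u], and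
   [e - e'] is the error. *)
have zid (A : zmodType) (p q d d' e e' : A) :
    d + p + q + e - (d' + q + p + e') = (d - d') + (e - e').
  rewrite -[d + p + q]addrA -[d' + q + p]addrA [q + p]addrC.
  rewrite [d + _ + e]addrAC [d' + _ + e']addrAC.
  by rewrite opprD [LHS]addrACA subrr addr0 opprD [LHS]addrACA.
rewrite !scalerDr !scalerA [(par k (+) _) && _]andbC -/s !mulrA -[s * s]expr2.
rewrite sqrr_sign mul1r -[s * _ * _]mulrA [s * (_ * _)]mulrC.
rewrite [(-1) ^+ (a && (par k (+) _)) * _]mulrC zid.
have zs (c t : K) (v w z : U) : c *: (v * w) - (c * t) *: (v * z) = c *: (v * (w - t *: z)).
  by rewrite mulrBr scalerBr -scalerAr scalerA.
rewrite zs; apply: FilD; first exact/FilZ/Fil_mulg_sub.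
by rewrite subSS; apply: FilB => //; apply: FilZ.
Qed.

Lemma lie_linear_right x c y y' : lie x (c *: y + y') = c *: lie x y + lie x y'.
Proof. exact: lie_linearr. Qed.

(* [M] is the matrix of the functional [y |-> (lie x y) i j]. *)
Lemma D_ad a x i j (M : 'M[K]_N) r u : homog a x ->
  (forall k l, M k l != 0 -> par k (+) par l = a (+) (par i (+) par j)) ->
  (forall b y, homog b y -> lie x y i j = \sum_k \sum_l M k l * y k l) ->
  Fil r u ->
  Fil (r - 2) (D i j (ad x u)
     - (-1) ^+ (a && (par i (+) par j)) *: ad x (D i j u)
     - \sum_k \sum_l M k l *: D k l u).
Proof.
move=> hx hM MP; set p := par i (+) par j in hM *; set s := (-1) ^+ _.
pose L v := \sum_k \sum_l M k l *: D k l v.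
have L_lin : linear L.
  move=> c v w; rewrite /L scaler_sumr -big_split; apply: eq_bigr => k _ /=.
  rewrite scaler_sumr -big_split; apply: eq_bigr => l _ /=.
  by rewrite DD DZ scalerDr !scalerA mulrC.
pose LL : {linear U -> U} := HB.pack L (GRing.isLinear.Build K U U *:%R L L_lin).
move: r u; rewrite -/(L _).
(* [T] measures the failure of the partial derivatives to be equivariant. Each of its terms lowers
   the filtration by one, their combination by two. *)
pose T := (D i j \o ad x) \- (s \*: (ad x \o D i j)) \- LL.
apply: (@Fil_lower _ _ 2 T (linearP _)); rewrite /T /=.
  rewrite ad1 D1 !linear0 !add0r /L big1 ?oppr0 // => k _; rewrite big1 // => l _.
  by rewrite D1 scaler0.
move=> r b y u hy Fu IH.
have adD v w : ad x (v + w) = ad x v + ad x w by exact: linearD.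
have adZ c v : ad x (c *: v) = c *: ad x v by exact: linearZ.
have [w1 Fw1 E1] := D_mul_mod i j (lie_homog _ _ _ _ hx hy) Fu.
have [w2 Fw2 E2] := D_mul_mod i j hy (Fil_ad x Fu).
have [w3 Fw3 E3] := D_mul_mod i j hy Fu.
have [w4 Fw4 E4] : exists2 w, Fil (r - 1) w & L (inj y * u) =
    (-1) ^+ (b && (a (+) p)) *: (inj y * L u) + lie x y i j *: u + w.
  exists (\sum_k \sum_l M k l *: \sum_m y k m *: D m l u).
    apply: Fil_sum => k _; apply: Fil_sum => l _; apply: FilZ.
    by apply: Fil_sum => m _; apply/FilZ/Fil_D.
  rewrite (MP _ _ hy) scaler_suml mulr_sumr scaler_sumr -!big_split /=.
  apply: eq_bigr => k _; rewrite scaler_suml mulr_sumr scaler_sumr -!big_split /=.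
  apply: eq_bigr => l _; rewrite (D_mul _ _ _ hy) !scalerDr !scalerA -scalerAr scalerA.
  congr (_ *: _ + _ + _); rewrite mulrC.
  by have [->|/hM ->//] := eqVneq (M k l) 0; rewrite !mulr0.
rewrite (ad_mul _ hx hy) DD DZ E1 E2 E3 E4 !(adD, adZ) (ad_mul _ hx hy).
(* The terms [P], [l'] and [q], in which the bracket or the derivative has hit [y], cancel; what
   remains is [y] times [T u], and errors. *)
have zid (A : zmodType) (P l' q d f h e1 e2 e3 e4 : A) :
      P + l' + e1 + (d + q + e2) - (P + f + q + e3) - (h + l' + e4)
      = (d - f - h) + (e1 + e2 - e3 - e4).
  have -> : P + l' + e1 + (d + q + e2) = (d + (e1 + e2)) + ((P + q) + l').
    by rewrite [LHS](AC (3*3) ((4*(3*6))*((1*5)*2))).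
  have -> : P + f + q + e3 = (f + e3) + (P + q).
    by rewrite [LHS](AC 4 ((2*4)*(1*3))).
  rewrite [h + l' + e4]addrAC -[LHS]addrA -opprD [X in - X]addrACA.
  rewrite opprD [LHS]addrACA subrr addr0 [X in - X]addrACA opprD [LHS]addrACA.
  by rewrite !opprD !addrA.
have sP : (-1) ^+ (a && b) * y i j = s * y i j.
  by rewrite (sign_entry _ _ _ hy).
pose t : K := (-1) ^+ (b && (a (+) p)).
have s1 : (-1) ^+ (a && b) * (-1) ^+ (b && p) = t.
  by rewrite [a && b]andbC -signr_addb -andb_addr.
have s2 : (-1) ^+ ((a (+) b) && p) = s * (-1) ^+ (b && p).
  by rewrite andb_addl signr_addb.
rewrite -/p s2 -/t !scalerDr !scalerA s1 sP zid.
have -> : s * (-1) ^+ (b && p) * (-1) ^+ (a && b) = t * s.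
  by rewrite -mulrA [_ ^+ (b && p) * _]mulrC s1 mulrC.
have zs (v w z : U) : t *: (inj y * v) - (t * s) *: (inj y * w) - t *: (inj y * z)
    = t *: (inj y * (v - s *: w - z)).
  by rewrite !mulrBr !scalerBr -scalerAr scalerA.
rewrite zs; apply: FilD; first exact/FilZ/Fil_mulg_sub.
rewrite subSS; apply: FilB => //; apply: FilB; last exact/FilZ/Fil_ad.
by apply: FilD => //; apply: FilZ.
Qed.

(* The lower right block is ignored, as on [g] the upper left one determines it. *)
Definition periplectic_proj (X : 'M[K]_N) : 'M[K]_N :=
  block_mx (ulsubmx X) (2^-1 *: (ursubmx X + (ursubmx X)^T))
    (2^-1 *: (dlsubmx X - (dlsubmx X)^T)) (- (ulsubmx X)^T).

Lemma periplectic_proj_in X : periplectic_proj X \in @is_periplectic K n.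
Proof.
apply/is_periplecticP; do 3!eexists; split; first by [].
  by rewrite linearZ linearD /= trmxK addrC.
by rewrite linearZ linearB /= trmxK -scalerN opprB.
Qed.

(** Dual to the matrix entries in the sense of [frame_sum], but overcomplete: the lower right ones
    vanish, and in the odd blocks transposed indices give the same element up to sign. *)
Definition frame i j : g := Periplectic (periplectic_proj_in (delta_mx i j)).

Lemma periplectic_proj_linear : linear periplectic_proj.
Proof.
move=> c X Y; rewrite /periplectic_proj scale_block_mx add_block_mx.
congr block_mx; apply/matrixP=> p q; rewrite !mxE //.
all: by ring.
Qed.

Lemma periplectic_proj_id x : periplectic_proj x = x.
Proof.
case: x => X /= /is_periplecticP[A [B [C [-> sB sC]]]]; rewrite /periplectic_proj.
rewrite block_mxKul block_mxKur block_mxKdl sB sC opprK.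
rewrite -mulr2n -[in X in block_mx _ _ X]mulr2n -!scaler_nat !scalerA.
by rewrite mulVf ?pnatr_eq0 // !scale1r.
Qed.

HB.instance Definition _ :=
  GRing.isLinear.Build K 'M[K]_N 'M[K]_N *:%R periplectic_proj periplectic_proj_linear.

Lemma frame_sum x : x = \sum_i \sum_j x i j *: frame i j.
Proof.
apply/val_inj; rewrite /= -[LHS]periplectic_proj_id {1}[periplectic_mx x]matrix_sum_delta.
have vD I (s : seq I) P (f : I -> g) : periplectic_mx (\sum_(i <- s | P i) f i)
    = \sum_(i <- s | P i) periplectic_mx (f i) by exact: (raddf_sum \val).
rewrite vD linear_sum; apply: eq_bigr => i _; rewrite vD linear_sum.
by apply: eq_bigr => j _; rewrite linearZ.
Qed.

Lemma frame_homog i j : homog (par i (+) par j) (frame i j).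
Proof.
apply/val_inj=> /=; rewrite /periplectic_proj /mx_hpart -(splitK i) -(splitK j).
rewrite block_mxKul block_mxKur block_mxKdl block_mxKdr.
case: (split i) => i'; case: (split j) => j' /=; rewrite ?par_lshift ?par_rshift /=;
  congr block_mx; apply/matrixP=> p q; rewrite !mxE !eq_shift /=;
  by rewrite ?andbF ?mulr0n ?addr0 ?subr0 ?mulr0 ?oppr0.
Qed.

(** Euler's identity: the sum multiplies the leading part of [u] by its degree, which is [r.-1]
    because of the shift. *)
Lemma euler r u : Fil r u ->
  Fil r.-1 (\sum_i \sum_j inj (frame i j) * D i j u - r.-1%:R *: u).
Proof.
pose E v := \sum_i \sum_j inj (frame i j) * D i j v.
rewrite -/(E u).
have E_lin c v w : E (c *: v + w) = c *: E v + E w.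
  rewrite /E scaler_sumr -big_split; apply: eq_bigr => i _ /=.
  rewrite scaler_sumr -big_split; apply: eq_bigr => j _ /=.
  by rewrite DD DZ mulrDr scalerAr.
elim=> {r u} [r|r|r c u v _ IHu _ IHv|r b x u hx Fu IHu].
- have := E_lin (-1) 0 0; rewrite !scaleN1r !addNr => ->.
  by rewrite scaler0 subr0; apply: Fil_zero.
- rewrite [E 1]big1 => [|i _]; last by rewrite big1 // => j _; rewrite D1 mulr0.
  rewrite sub0r /=; apply: FilN; case: r => [|r]; last exact/FilZ/Fil_one.
  by rewrite scale0r; apply: Fil_zero.
- rewrite E_lin scalerDr opprD addrACA scalerA mulrC -scalerA -scalerBr.
  exact: Fil_lin.
case: r Fu IHu => [/Fil0-> _|r Fu IHu].
  have := E_lin (-1) 0 0; rewrite !scaleN1r !addNr mulr0 => ->.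
  by rewrite scaler0 subr0; apply: Fil_zero.
have Fd i j : Fil r (D i j u) by have := Fil_D i j Fu; rewrite subn1.
have [w Fw ->] : exists2 w, Fil r.+1 w & E (inj x * u) = inj x * E u + inj x * u + w.
  (* The error collects the brackets from moving [frame i j] past [x] and the lower order sums of
     [D_mul]. *)
  exists (\sum_i \sum_j (
     (-1) ^+ (b && (par i (+) par j)) *: (inj (lie (frame i j) x) * D i j u)
     + inj (frame i j) * \sum_k x i k *: D k j u)).
    apply: Fil_sum => i _; apply: Fil_sum => j _; apply: FilD.
      by apply/FilZ/Fil_mulg.
    by apply: Fil_mulg; apply: Fil_sum => k _; apply/FilZ.
  (* Expanding [x] in the frame identifies the extra copy of [inj x * u], which raises the degree by
     one. *)
  have -> : inj x * E u + inj x * u = inj x * E u + \sum_i \sum_j (x i j *: inj (frame i j) * u).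
    congr (_ + _); rewrite {1}(frame_sum x) linear_sum mulr_suml; apply: eq_bigr => i _.
    rewrite linear_sum mulr_suml; apply: eq_bigr => j _.
    by rewrite linearZ.
  rewrite /E mulr_sumr -!big_split; apply: eq_bigr => i _ /=.
  rewrite mulr_sumr -!big_split; apply: eq_bigr => j _ /=.
  rewrite (D_mul _ _ _ hx) !mulrDr -!scalerAr !mulrA.
  rewrite (iota_lie (frame_homog i j) hx) [_ && b]andbC mulrBl scalerBr -!scalerAl scalerA.
  rewrite -expr2 sqrr_sign scale1r addrA; congr (_ + _).
  by rewrite [RHS]addrC addrA subrK.
rewrite /= -natr1 scalerDl scale1r.
have -> : inj x * E u + inj x * u + w - (r%:R *: (inj x * u) + inj x * u)
   = inj x * (E u - r%:R *: u) + w.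
  rewrite mulrBr -scalerAr opprD; move: (inj x * E u) (inj x * u) => A B.
  by rewrite [A + B + w]addrAC [- _ - B]addrC addrA addrK addrAC.
by apply: FilD => //; apply: Fil_mulg.
Qed.

(** By [euler], [r.+1%:R *: u] is congruent to a sum that has level [r.+1] by hypothesis; divide by
    [r.+1] in characteristic 0. *)
Lemma Fil_of_D r u :
  Fil r.+2 u -> (forall i j, Fil r (D i j u)) -> Fil r.+1 u.
Proof.
move=> Fu FD; have := euler Fu; set v := \sum_i _ => /= Fv.
have Fv' : Fil r.+1 v.
  by apply: Fil_sum => i _; apply: Fil_sum => j _; apply: Fil_mulg.
have := FilZ (r.+1%:R^-1) (FilB Fv' Fv).
by rewrite opprB addrC subrK scalerA mulVf ?pnatr_eq0 // scale1r.
Qed.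

End Derivations.

(** * Invariant forms *)

Section PermSwap.
Variables (T : eqType) (P : seq T -> Prop).
Hypothesis Pswap : forall s1 x y s2, P (s1 ++ x :: y :: s2) -> P (s1 ++ y :: x :: s2).

(** Adjacent transpositions generate all permutations; the induction is over an arbitrary prefix. *)
Lemma perm_swap_ind s t : perm_eq s t -> P s -> P t.
Proof.
have mv p x s1 s2 : P (p ++ x :: s1 ++ s2) -> P (p ++ s1 ++ x :: s2).
  elim: s1 p => [|y s1 IH] p //= /Pswap; rewrite -[p ++ y :: _]cat_rcons => /IH.
  by rewrite cat_rcons.
suff gen p : perm_eq s t -> P (p ++ s) -> P (p ++ t) by apply: (gen [::]).
elim: s t p => [|x s IH] t p; first by rewrite perm_sym => /perm_nilP->.
move=> st; have xt : x \in t by rewrite -(perm_mem st) mem_head.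
case/splitPr: xt st => t1 t2.
rewrite perm_sym -cat1s perm_catCA /= perm_cons perm_sym => st.
by rewrite -cat_rcons => /(IH _ _ st); rewrite cat_rcons; apply: mv.
Qed.
End PermSwap.

(** * Iterated partial derivatives in top order *)

Section IteratedDerivations.
Variables (K : numFieldType) (n : nat).
Local Notation g := (periplectic K n).
Local Notation U := (env g).
Local Notation N := (n + n)%N.
Local Notation letter := ('I_N * 'I_N)%type.
Implicit Types (u v w : U) (x y : g) (a b e : bool) (r : nat) (s t : seq letter).

Lemma ad_Fil1 x u : Fil 1 u -> ad x u = 0.
Proof. by case/Fil1 => c ->; apply: ad_scale. Qed.

Definition lpar (p : letter) := par p.1 (+) par p.2.

Definition Ds s u : U := foldr (fun p : letter => D p.1 p.2) u s.

Lemma Ds_linear s : linear (Ds s).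
Proof. by elim: s => [|p s IH] c u v //=; rewrite IH DD DZ. Qed.
HB.instance Definition _ s := GRing.isLinear.Build K U U *:%R (Ds s) (Ds_linear s).

Lemma Ds_cat s t u : Ds (s ++ t) u = Ds s (Ds t u).
Proof. exact: foldr_cat. Qed.

Lemma Ds_rcons s p u : Ds (rcons s p) u = Ds s (D p.1 p.2 u).
Proof. by rewrite -cats1 Ds_cat. Qed.

Lemma Fil_Ds r s u : Fil r u -> Fil (r - size s) (Ds s u).
Proof.
elim: s => [|p s IH] Fu /=; first by rewrite subn0.
by rewrite -addn1 subnDA; apply/Fil_D/IH.
Qed.

Lemma Ds_mod s u v : Fil (size s) (u - v) -> Ds s u = Ds s v.
Proof.
move/(@Fil_Ds _ s); rewrite subnn => /Fil0/eqP.
by rewrite linearB subr_eq0 => /eqP.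
Qed.

(** The order of [u] is at most the number of derivatives, so the remaining ones kill the error of
    [D_swap]. *)
Lemma Ds_swap s1 p q s2 u : Fil (size s1 + size s2).+3 u ->
  Ds (s1 ++ p :: q :: s2) u = (-1) ^+ (lpar p && lpar q) *: Ds (s1 ++ q :: p :: s2) u.
Proof.
rewrite !Ds_cat /= -linearZ => Fu; apply: Ds_mod.
have /(@D_swap _ _ _ p.1 p.2 q.1 q.2) := @Fil_Ds _ s2 _ Fu.
apply: Fil_le; lia.
Qed.

Lemma Ds_perm0 s t u : Fil (size s).+1 u -> perm_eq s t -> Ds s u = 0 -> Ds t u = 0.
Proof.
move=> Fu st s0; pose P s := Fil (size s).+1 u -> Ds s u = 0.
apply: (@perm_swap_ind _ P _ s t st) => //; rewrite /P.
  move=> s1 p q s2 IH Fu'; have sz : size (s1 ++ q :: p :: s2) = (size s1 + size s2).+2.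
    by rewrite size_cat /= !addnS.
  rewrite sz in Fu'; rewrite Ds_swap // IH ?scaler0 //.
  by rewrite size_cat /= !addnS.
by rewrite -(perm_size st).
Qed.

(** The functional eps_i; the lower right diagonal entries are the opposites of these. *)
Definition diagl (i : 'I_n) : letter := (lshift n i, lshift n i).
Definition Dh (hs : seq 'I_n) := Ds (map diagl hs).

Lemma lpar_diagl i : lpar (diagl i) = false.
Proof. by rewrite /lpar addbb. Qed.

Lemma Dh_cat hs hs' u : Dh (hs ++ hs') u = Dh hs (Dh hs' u).
Proof. by rewrite /Dh map_cat Ds_cat. Qed.

Lemma Fil_Dh r hs u : Fil r u -> Fil (r - size hs) (Dh hs u).
Proof. by move/(@Fil_Ds _ (map diagl hs)); rewrite size_map. Qed.

Lemma Dh_perm hs hs' u : Fil (size hs).+1 u -> perm_eq hs hs' -> Dh hs u = Dh hs' u.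
Proof.
move=> Fu st.
pose P hs1 := Fil (size hs1).+1 u -> Dh hs u = Dh hs1 u.
apply: (@perm_swap_ind _ P _ hs hs' st) => //; rewrite /P.
  move=> s1 p q s2 IH Fu'; rewrite IH; last by move: Fu'; rewrite !size_cat.
  rewrite /Dh !map_cat /= Ds_swap ?lpar_diagl ?scale1r //.
  by move: Fu'; rewrite size_cat !size_map /= !addnS.
by rewrite -(perm_size st).
Qed.

Lemma Ds_Dh_comm s p hs u : Fil (size s + size hs).+2 u ->
  Ds s (D p.1 p.2 (Dh hs u)) = Ds s (Dh hs (D p.1 p.2 u)).
Proof.
elim: hs s => [|i hs IH] s Fu //.
transitivity (Ds (rcons s (diagl i)) (D p.1 p.2 (Dh hs u))); last first.
  rewrite IH ?Ds_rcons //; move: Fu; by rewrite size_rcons /= addnS.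
have := @Ds_swap s p (diagl i) (map diagl hs) u; rewrite lpar_diagl andbF scale1r.
rewrite !Ds_cat /= => E; rewrite Ds_rcons; apply: E.
by move: Fu; rewrite size_map /= !addnS.
Qed.

(** In top order the error of [D_ad] disappears: [ad x] crosses a letter exactly, at the cost of the
    coadjoint action on it. *)
Lemma Ds_ad a x p (M : 'M[K]_N) s u : homog a x ->
  (forall k l, M k l != 0 -> par k (+) par l = a (+) lpar p) ->
  (forall b y, homog b y -> lie x y p.1 p.2 = \sum_k \sum_l M k l * y k l) ->
  Fil (size s).+2 u ->
  Ds s (D p.1 p.2 (ad x u)) = (-1) ^+ (a && lpar p) *: Ds s (ad x (D p.1 p.2 u))
    + \sum_k \sum_l M k l *: Ds s (D k l u).
Proof.
move=> hx hM MP Fu.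
have -> : \sum_k \sum_l M k l *: Ds s (D k l u) = Ds s (\sum_k \sum_l M k l *: D k l u).
  rewrite linear_sum; apply: eq_bigr => k _; rewrite linear_sum.
  by apply: eq_bigr => l _; rewrite linearZ.
rewrite -linearZ -linearD; apply: Ds_mod.
by have := D_ad hx hM MP Fu; rewrite -addn2 addnK opprD addrA.
Qed.

Lemma sum_delta (V : lmodType K) (f : 'I_N -> 'I_N -> V) i j :
  \sum_k \sum_l (delta_mx i j : 'M[K]_N) k l *: f k l = f i j.
Proof.
rewrite (bigD1 i) //= [X in _ + X]big1 => [|k /negbTE ki]; last first.
  by rewrite big1 // => l _; rewrite mxE ki scale0r.
rewrite (bigD1 j) //= big1 => [|l /negbTE lj]; last first.
  by rewrite mxE lj andbF scale0r.
by rewrite mxE !eqxx scale1r !addr0.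
Qed.

Lemma Ds_ad1 a x p q (c : K) s u : homog a x -> (c != 0 -> lpar q = a (+) lpar p) ->
  (forall b y, homog b y -> lie x y p.1 p.2 = c * y q.1 q.2) ->
  Fil (size s).+2 u ->
  Ds s (D p.1 p.2 (ad x u)) = (-1) ^+ (a && lpar p) *: Ds s (ad x (D p.1 p.2 u))
    + c *: Ds s (D q.1 q.2 u).
Proof.
move=> hx hc cP Fu; rewrite (@Ds_ad a x p (c *: delta_mx q.1 q.2) s u hx _ _ Fu).
- congr (_ + _); rewrite -[in RHS](sum_delta (fun k l => Ds s (D k l u))).
  rewrite scaler_sumr; apply: eq_bigr => k _; rewrite scaler_sumr.
  by apply: eq_bigr => l _; rewrite [(_ *: _ : 'M_N) k l]mxE scalerA.
- move=> k l; rewrite !mxE; have [->|_] := eqVneq k q.1; last by rewrite mulr0 eqxx.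
  by have [->|_] := eqVneq l q.2; rewrite ?mulr0 ?eqxx // mulr1 => /hc.
- move=> b y hy; rewrite (cP b y hy) -(@sum_delta K^o (fun k l => y k l)).
  rewrite mulr_sumr; apply: eq_bigr => k _; rewrite mulr_sumr.
  by apply: eq_bigr => l _; rewrite [(_ *: _ : 'M_N) k l]mxE mulrA.
Qed.

End IteratedDerivations.

(** * Removing an off-diagonal argument with an opposite root vector *)

Section InvariantElements.
Variables (K : numFieldType) (n : nat).
Local Notation g := (periplectic K n).
Local Notation U := (env g).
Local Notation N := (n + n)%N.
Local Notation letter := ('I_N * 'I_N)%type.
Implicit Types (u v w : U) (x y : g) (a b e : bool) (r : nat) (s t : seq letter).

(** When the letters of [s] are eigenvectors of [x], crossing them adds up the eigenvalues, without
    signs. The induction hands the letters of [s] over to [t] one by one. *)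
Lemma Ds_ad_eigen a x (c : letter -> K) s t u : homog a x ->
  (forall p, p \in s -> [/\ a && lpar p = false, c p != 0 -> a = false &
     forall b y, homog b y -> lie x y p.1 p.2 = c p * y p.1 p.2]) ->
  Fil (size s + size t).+1 u ->
  Ds t (Ds s (ad x u)) = Ds t (ad x (Ds s u)) + (\sum_(p <- s) c p) *: Ds t (Ds s u).
Proof.
move=> hx; elim: s t => [|p s IH] t sP Fu; first by rewrite big_nil scale0r addr0.
have [ap c0 cP] := sP p (mem_head _ _).
rewrite /= -!Ds_rcons IH; last first.
- by move: Fu; rewrite size_rcons /= addnS.
- by move=> q qs; apply: sP; rewrite inE qs orbT.
rewrite !Ds_rcons big_cons scalerDl addrA; congr (_ + _).
rewrite (@Ds_ad1 _ _ a x p p (c p) t _ hx) //; first by rewrite ap expr0 scale1r.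
  by move/c0->.
apply: Fil_le (Fil_Ds s Fu); rewrite /= in Fu *; lia.
Qed.

Section Fixed.
Variables (d : nat) (z : U).
Hypotheses (z_inv : forall x, ad x z = 0) (Fz : Fil d.+1 z).

(* Applying [x] to the argument list [i0 :: hs] replaces one [i0] (resp. [j0]) by
   [q] with coefficient [c] (resp. [- c]), and changes nothing else up to terms
   with at most [size s] off-diagonal arguments; whence an induction on the
   number of occurrences of [j0] in [hs]. *)
Lemma opposite_root a x q (c : K) (i0 j0 : 'I_n) s hs :
  homog a x -> lpar q = a -> c != 0 -> i0 != j0 ->
  (forall (k : 'I_n) b y, homog b y -> lie x y (lshift n k) (lshift n k)
     = c * ((k == i0)%:R - (k == j0)%:R) * y q.1 q.2) ->
  (forall t hs', size t = size s -> (size hs' + size t = d)%N -> Dh hs' (Ds t z) = 0) ->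
  (size hs + (size s).+1 = d)%N -> Dh hs (D q.1 q.2 (Ds s z)) = 0.
Proof.
move=> hx qa c0 ij cP IH; set v := Ds s z; set u := D _ _ v.
(* Carrying [ad x] from [z] outwards across [s] leaves only terms with [size s] letters besides
   those of [hs']; they vanish by [IH]. *)
have adv hs' : (size hs' + size s = d)%N -> Dh hs' (ad x v) = 0.
  move=> sz; suff gen t t' : size (t ++ t') = size s ->
      Ds (map (@diagl n) hs' ++ t) (ad x (Ds t' z)) = 0.
    by have := gen [::] s erefl; rewrite cats0.
  elim: t' t => [|p t' IHt] t szt; first by rewrite /= z_inv linear0.
  have Ft : Fil (size (map (@diagl n) hs' ++ t)).+2 (Ds t' z).
    apply: Fil_le (Fil_Ds t' Fz); move: szt; rewrite !size_cat size_map /=; lia.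
  (* The coadjoint action of [x] on the letter [p], in frame coordinates. *)
  pose M : 'M[K]_N := \matrix_(k, l) lie x (frame K k l) p.1 p.2.
  have hM k l : M k l != 0 -> par k (+) par l = a (+) lpar p.
    rewrite mxE => /eqP ne; apply/eqP/negPn/negP=> ne'; apply: ne.
    apply: (homog_entry (lie_homog _ _ _ _ hx (frame_homog K k l))).
    by apply: contra ne' => /eqP; rewrite /lpar => ->; rewrite addKb.
  have MP b y : homog b y -> lie x y p.1 p.2 = \sum_k \sum_l M k l * y k l.
    move=> _; rewrite {1}(frame_sum y).
    pose f0 (w : g) : K^o := lie x w p.1 p.2.
    have lD : linear f0.
      by move=> e y1 y2; rewrite /f0 lie_linear_right [LHS]mxE [X in X + _]mxE.
    pose f : {linear g -> K^o} := HB.pack f0 (GRing.isLinear.Build K g K^o *:%R f0 lD).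
    rewrite -[LHS]/(f _) linear_sum; apply: eq_bigr => k _.
    rewrite linear_sum; apply: eq_bigr => l _.
    by rewrite linearZ mxE mulrC.
  have := IHt (rcons t p); rewrite cat_rcons => /(_ szt).
  rewrite -rcons_cat Ds_rcons (Ds_ad hx hM MP Ft).
  rewrite [X in _ + X]big1 ?addr0 => [|k _]; last first.
    rewrite big1 // => l _.
    have -> : Ds (map (@diagl n) hs' ++ t) (D k l (Ds t' z)) = Dh hs' (Ds (t ++ (k, l) :: t') z).
      by rewrite /Dh !Ds_cat.
    by rewrite IH ?scaler0 //; move: sz szt; rewrite !size_cat /=; lia.
  by move/eqP; rewrite scaler_eq0 signr_eq0 => /eqP.
have Fv : Fil (d.+1 - size s) v by apply: Fil_Ds.
have [m] := ubnP (count_mem j0 hs); elim: m hs => // m IHm hs ltm sz.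
(* Carrying [ad x] on across [hs1]: each [i0] in it contributes [c], and outside all letters [ad x]
   meets a scalar, which it kills. *)
have key (hs1 hs2 : seq 'I_n) : perm_eq (hs1 ++ hs2) (i0 :: hs) ->
    Dh hs1 (ad x (Dh hs2 v)) = (c * (count_mem i0 hs1)%:R) *: Dh hs u.
  elim/last_ind: hs1 hs2 => [|hs1 k IHk] hs2 pe.
    rewrite mulr0 scale0r [LHS]ad_Fil1 //; apply: Fil_le (Fil_Dh hs2 Fv).
    by move: (perm_size pe) => /=; lia.
  rewrite cat_rcons in pe.
  have szk : (size hs1 + size hs2 = size hs)%N.
    by move: (perm_size pe); rewrite size_cat /= addnS => -[].
  have cntk l : (count_mem l (hs1 ++ hs2) + (k == l) = (i0 == l) + count_mem l hs)%N.
    by move/permP: pe => /(_ (pred1 l)); rewrite !count_cat /=; lia.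
  have qk : lpar q = a (+) lpar (diagl k) by rewrite lpar_diagl addbF.
  have Fk : Fil (size (map (@diagl n) hs1)).+2 (Dh hs2 v).
    by apply: Fil_le (Fil_Dh hs2 Fv); rewrite size_map; lia.
  have -> w : Dh (rcons hs1 k) w = Ds (map (@diagl n) hs1) (D (diagl k).1 (diagl k).2 w).
    by rewrite /Dh map_rcons Ds_rcons.
  rewrite (Ds_ad1 hx (fun _ => qk) (cP k) Fk).
  rewrite lpar_diagl andbF expr0 scale1r -/(Dh hs1 _) (IHk (k :: hs2) pe).
  rewrite Ds_Dh_comm; last by apply: Fil_le Fv; rewrite size_map; lia.
  rewrite -/(Dh hs1 _) -Dh_cat -/u -cats1 count_cat /= addn0.
  rewrite [in RHS]natrD [in RHS]mulrDr [RHS]scalerDl.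
  congr (_ + _); have [ki|ki] := eqVneq k i0.
    rewrite ki (negbTE ij) subr0 (@Dh_perm _ _ (hs1 ++ hs2) hs) //.
      by rewrite size_cat szk; apply: Fil_le (Fil_D _ _ Fv); lia.
    by move: pe; rewrite -[k :: hs2]cat1s perm_catCA ki perm_cons.
  (* Replacing a [j0] leaves a list with one [j0] fewer than [hs], so [IHm] applies. *)
  rewrite mulr0 scale0r; have [kj|_] := eqVneq k j0; last by rewrite subrr mulr0 scale0r.
  rewrite IHm ?scaler0 //; last by rewrite size_cat szk.
  by have := cntk j0; rewrite kj eqxx (negbTE ij); lia.
(* The added [i0] makes the count positive, hence nonzero in characteristic 0. *)
have := key (i0 :: hs) [::]; rewrite cats0 => /(_ (perm_refl _)).
rewrite [Dh [::] v]/= adv /=; last by lia.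
move/esym/eqP; rewrite scaler_eq0 mulf_eq0 (negbTE c0) /= pnatr_eq0 eqxx /=.
by move/eqP.
Qed.
End Fixed.
End InvariantElements.

(** * Root vectors of p_n *)

Section RootVectors.
Variables (K : numFieldType) (n : nat).
Local Notation g := (periplectic K n).
Local Notation N := (n + n)%N.
Implicit Types (x y : g) (a b : bool) (i j k l : 'I_n) (X Y : 'M[K]_N).

Lemma ulsubmx_mul X Y :
  ulsubmx (X *m Y) = ulsubmx X *m ulsubmx Y + ursubmx X *m dlsubmx Y.
Proof. by rewrite -{1}[X]submxK -{1}[Y]submxK mulmx_block block_mxKul. Qed.

Lemma ursubmx_mul X Y :
  ursubmx (X *m Y) = ulsubmx X *m ursubmx Y + ursubmx X *m drsubmx Y.
Proof. by rewrite -{1}[X]submxK -{1}[Y]submxK mulmx_block block_mxKur. Qed.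

Lemma lie_ul a b x y k l : homog a x -> homog b y ->
  lie x y (lshift n k) (lshift n l) =
    (ulsubmx x *m ulsubmx y + ursubmx x *m dlsubmx y) k l
    - (-1) ^+ (a && b) * (ulsubmx y *m ulsubmx x + ursubmx y *m dlsubmx x) k l.
Proof.
move=> hx hy; rewrite -!ulsubmx_mul (lie_mx hx hy).
by rewrite [LHS]mxE [X in _ + X]mxE [X in - X]mxE; congr (_ - _ * _);
  rewrite [RHS]mxE [RHS]mxE.
Qed.

Lemma lie_ur a b x y k l : homog a x -> homog b y ->
  lie x y (lshift n k) (rshift n l) =
    (ulsubmx x *m ursubmx y + ursubmx x *m drsubmx y) k l
    - (-1) ^+ (a && b) * (ulsubmx y *m ursubmx x + ursubmx y *m drsubmx x) k l.
Proof.
move=> hx hy; rewrite -!ursubmx_mul (lie_mx hx hy).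
by rewrite [LHS]mxE [X in _ + X]mxE [X in - X]mxE; congr (_ - _ * _);
  rewrite [RHS]mxE [RHS]mxE.
Qed.

Lemma mul_delta_l i j (A : 'M[K]_n) k l : (delta_mx i j *m A) k l = (k == i)%:R * A j l.
Proof.
rewrite mxE (bigD1 j) //= !mxE eqxx andbT big1 ?addr0 // => m /negbTE mj.
by rewrite !mxE mj andbF mul0r.
Qed.

Lemma mul_delta_r i j (A : 'M[K]_n) k l : (A *m delta_mx i j) k l = A k i * (l == j)%:R.
Proof.
rewrite mxE (bigD1 i) //= !mxE eqxx /= big1 ?addr0 // => m /negbTE mj.
by rewrite !mxE mj mulr0.
Qed.

Lemma ulsubmxE X i j : ulsubmx X i j = X (lshift n i) (lshift n j).
Proof. by rewrite !mxE. Qed.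
Lemma ursubmxE X i j : ursubmx X i j = X (lshift n i) (rshift n j).
Proof. by rewrite !mxE. Qed.
Lemma dlsubmxE X i j : dlsubmx X i j = X (rshift n i) (lshift n j).
Proof. by rewrite !mxE. Qed.
Lemma drsubmxE X i j : drsubmx X i j = X (rshift n i) (rshift n j).
Proof. by rewrite !mxE. Qed.

Lemma delta_dep k i (f : 'I_n -> K) : (k == i)%:R * f k = (k == i)%:R * f i.
Proof. by have [->|_] := eqVneq k i; rewrite ?mul0r. Qed.

Definition submx_entry := (ulsubmxE, ursubmxE, dlsubmxE, drsubmxE).

Lemma periplectic_entry x i j :
  [/\ x (rshift n i) (rshift n j) = - x (lshift n j) (lshift n i),
      x (lshift n i) (rshift n j) = x (lshift n j) (rshift n i)
    & x (rshift n i) (lshift n j) = - x (rshift n j) (lshift n i)].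
Proof.
case/and3P: (valP x) => /eqP/matrixP/(_ i j) E1 /eqP/matrixP/(_ j i) E2 /eqP/matrixP/(_ j i) E3.
by move: E1 E2 E3; rewrite !mxE.
Qed.

Lemma dr_periplectic x : drsubmx x = - (ulsubmx x)^T.
Proof. by case/and3P: (valP x) => /eqP. Qed.

Lemma frame_ll i j : [/\ ulsubmx (frame K (lshift n i) (lshift n j)) = delta_mx i j,
  ursubmx (frame K (lshift n i) (lshift n j)) = 0
  & dlsubmx (frame K (lshift n i) (lshift n j)) = 0].
Proof.
rewrite /= /periplectic_proj !(block_mxKul, block_mxKur, block_mxKdl).
split; apply/matrixP=> k l; rewrite !mxE !eq_shift /=;
  by rewrite ?andbF ?mulr0n ?addr0 ?subr0 ?mulr0.
Qed.

Lemma frame_lr i j : [/\ ulsubmx (frame K (lshift n i) (rshift n j)) = 0,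
  ursubmx (frame K (lshift n i) (rshift n j)) = 2^-1 *: (delta_mx i j + delta_mx j i)
  & dlsubmx (frame K (lshift n i) (rshift n j)) = 0].
Proof.
rewrite /= /periplectic_proj !(block_mxKul, block_mxKur, block_mxKdl).
split; apply/matrixP=> k l; rewrite !mxE !eq_shift /=;
  by rewrite ?andbF ?mulr0n ?addr0 ?subr0 ?mulr0 // [(l == i) && _]andbC.
Qed.

Lemma frame_rl i j : [/\ ulsubmx (frame K (rshift n i) (lshift n j)) = 0,
  ursubmx (frame K (rshift n i) (lshift n j)) = 0
  & dlsubmx (frame K (rshift n i) (lshift n j)) = 2^-1 *: (delta_mx i j - delta_mx j i)].
Proof.
rewrite /= /periplectic_proj !(block_mxKul, block_mxKur, block_mxKdl).
split; apply/matrixP=> k l; rewrite !mxE !eq_shift /=;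
  by rewrite ?andbF ?mulr0n ?addr0 ?subr0 ?mulr0 // [(l == i) && _]andbC.
Qed.

(** This and the next two lemmas feed [opposite_root]: the diagonal part of the bracket lies on the
    line of the i-th minus the j-th diagonal element. *)
Lemma opposite_ll i j k b y : homog b y ->
  lie (frame K (lshift n j) (lshift n i)) y (lshift n k) (lshift n k)
    = 1 * ((k == j)%:R - (k == i)%:R) * y (lshift n i) (lshift n j).
Proof.
move=> hy; have := frame_homog K (lshift n j) (lshift n i); rewrite !par_lshift /= => hx.
have [E1 E2 E3] := frame_ll j i.
rewrite (lie_ul _ _ hx hy) E1 E2 E3 mul0mx mulmx0 !addr0 mul_delta_l mul_delta_r.
rewrite !submx_entry expr0 [_ * (_ == i)%:R]mulrC.
rewrite (delta_dep k j (fun k => y (lshift n i) (lshift n k))).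
by rewrite (delta_dep k i (fun k => y (lshift n k) (lshift n j))); ring.
Qed.

Lemma opposite_rl i j k b y : homog b y ->
  lie (frame K (rshift n j) (lshift n i)) y (lshift n k) (lshift n k)
    = 2^-1 * ((k == i)%:R - (k == j)%:R) * y (lshift n i) (rshift n j).
Proof.
move=> hy; have := frame_homog K (rshift n j) (lshift n i).
rewrite par_rshift par_lshift /= => hx.
have [E1 E2 E3] := frame_rl j i.
rewrite (lie_ul _ _ hx hy) E1 E2 E3 !mul0mx mulmx0 !add0r -scalemxAr mulmxBr.
rewrite [(_ *: _ : 'M_n) k k]mxE [(_ - _ : 'M_n) k k]mxE [(- _ : 'M_n) k k]mxE.
rewrite !mul_delta_r !submx_entry [(0 : 'M_n) k k]mxE.
have sB k' l : (-1) ^+ (true && b) * y (lshift n k') (rshift n l) = - y (lshift n k') (rshift n l).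
  by rewrite (sign_entry true _ _ hy) par_lshift par_rshift expr1 mulN1r.
move: (sB k j) (sB k i); set t := (-1) ^+ _ => s1 s2.
transitivity (- (2^-1 * ((k == i)%:R * (t * y (lshift n k) (rshift n j))
   - (k == j)%:R * (t * y (lshift n k) (rshift n i))))); first by ring.
rewrite s1 s2 (delta_dep k i (fun k => - y (lshift n k) (rshift n j))).
rewrite (delta_dep k j (fun k => - y (lshift n k) (rshift n i))).
by have [_ -> _] := periplectic_entry y j i; ring.
Qed.

Lemma opposite_lr i j k b y : homog b y ->
  lie (frame K (lshift n i) (rshift n j)) y (lshift n k) (lshift n k)
    = 2^-1 * ((k == j)%:R - (k == i)%:R) * y (rshift n i) (lshift n j).
Proof.
move=> hy; have := frame_homog K (lshift n i) (rshift n j).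
rewrite par_rshift par_lshift /= => hx.
have [E1 E2 E3] := frame_lr i j.
rewrite (lie_ul _ _ hx hy) E1 E2 E3 !mul0mx !mulmx0 !add0r -scalemxAl mulmxDl.
rewrite [(_ *: _ : 'M_n) k k]mxE [(_ + _ : 'M_n) k k]mxE [(0 : 'M_n) k k]mxE.
rewrite !mul_delta_l !submx_entry mulr0 subr0.
rewrite (delta_dep k i (fun k => y (rshift n j) (lshift n k))).
rewrite (delta_dep k j (fun k => y (rshift n i) (lshift n k))).
by have [_ _ ->] := periplectic_entry y j i; ring.
Qed.

Lemma dl_diag x i : x (rshift n i) (lshift n i) = 0.
Proof.
have [_ _ /eqP] := periplectic_entry x i i.
by rewrite -addr_eq0 -mulr2n mulrn_eq0 => /eqP.
Qed.

(** Since -2 eps_i is not a root, the coefficient in [opposite_lr] vanishes for equal indices. *)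
Lemma lie_lr_diag i k b y : homog b y ->
  lie (frame K (lshift n i) (rshift n i)) y (lshift n k) (lshift n k) = 0.
Proof. by move=> hy; rewrite (opposite_lr _ _ _ hy) subrr mulr0 mul0r. Qed.

(** The root vector has weight 2 eps_i, and the sign comes from bracketing with it on the left. *)
Lemma lie_lr_self i b y : homog b y ->
  lie (frame K (lshift n i) (rshift n i)) y (lshift n i) (rshift n i)
    = - 2 * y (lshift n i) (lshift n i).
Proof.
move=> hy; have := frame_homog K (lshift n i) (rshift n i).
rewrite par_rshift par_lshift /= => hx.
have [E1 E2 E3] := frame_lr i i.
rewrite (lie_ur _ _ hx hy) !dr_periplectic E1 E2 mul0mx trmx0 oppr0 mulmx0 addr0 add0r.
rewrite -mulr2n -scaler_nat scalerA mulVf ?pnatr_eq0 // scale1r.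
rewrite mul_delta_l mul_delta_r !eqxx !mul1r mulr1.
rewrite !mxE andTb -[b]andTb (sign_entry true _ _ hy) par_lshift expr0.
by ring.
Qed.

Lemma grading_periplectic : (block_mx 1%:M 0 0 (- 1%:M) : 'M[K]_N) \in @is_periplectic K n.
Proof. by apply/is_periplecticP; exists 1%:M, 0, 0; rewrite !trmx0 oppr0 trmx1. Qed.
(** diag(1, -1), whose eigenvalues 0 and 2 on the upper blocks single out the letters of weight 2
    eps_i. *)
Definition grading : g := Periplectic grading_periplectic.

Lemma grading_homog : homog false grading.
Proof.
apply/val_inj => /=; rewrite /mx_hpart.
by rewrite block_mxKul block_mxKdr.
Qed.

Lemma lie_grading_ul k b y : homog b y -> lie grading y (lshift n k) (lshift n k) = 0.
Proof.
move=> hy; rewrite (lie_ul _ _ grading_homog hy) /= block_mxKul block_mxKur block_mxKdl.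
by rewrite mul0mx mulmx0 !addr0 mul1mx mulmx1 mul1r subrr.
Qed.

Lemma lie_grading_ur k l b y : homog b y ->
  lie grading y (lshift n k) (rshift n l) = 2 * y (lshift n k) (rshift n l).
Proof.
move=> hy; rewrite (lie_ur _ _ grading_homog hy) /= block_mxKul block_mxKur block_mxKdr.
rewrite mul0mx mulmx0 addr0 add0r mul1mx mulmxN mulmx1 mul1r [(- _ : 'M_n) k l]mxE.
by rewrite submx_entry; ring.
Qed.
End RootVectors.

(** * Vanishing of the top derivatives, and the center *)

Section Center.
Variables (K : numFieldType) (n : nat).
Local Notation g := (periplectic K n).
Local Notation U := (env g).
Local Notation N := (n + n)%N.
Local Notation letter := ('I_N * 'I_N)%type.
Implicit Types (u v w : U) (x y : g) (a b e : bool) (r : nat) (s t : seq letter).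

Lemma ad0 u : ad (0 : g) u = 0.
Proof. by apply: (@addrI _ (ad 0 u)); rewrite -adDl !addr0. Qed.

Lemma sum_combine (V : lmodType K) (f : 'I_N -> 'I_N -> V) (c : K) (p q : letter) :
  \sum_k \sum_l (delta_mx p.1 p.2 - c *: delta_mx q.1 q.2 : 'M[K]_N) k l *: f k l
    = f p.1 p.2 - c *: f q.1 q.2.
Proof.
rewrite -[in RHS](sum_delta f p.1) -[in RHS](sum_delta f q.1).
rewrite scaler_sumr -sumrB; apply: eq_bigr => k _.
rewrite scaler_sumr -sumrB; apply: eq_bigr => l _.
rewrite [(_ - _ : 'M_N) k l]mxE [(- _ : 'M_N) k l]mxE [(_ *: _ : 'M_N) k l]mxE.
by rewrite scalerBl scalerA.
Qed.

(** A linear relation between entries makes [M] a matrix of the zero functional on [g], so [Ds_ad]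
    for the element 0 yields the relation between derivatives. *)
Lemma Ds_lin p q (c : K) s u : lpar p = lpar q ->
  (forall y, y p.1 p.2 = c * y q.1 q.2) -> Fil (size s).+2 u ->
  Ds s (D p.1 p.2 u) = c *: Ds s (D q.1 q.2 u).
Proof.
move=> pq cP Fu; pose M : 'M[K]_N := delta_mx p.1 p.2 - c *: delta_mx q.1 q.2.
have h0 : homog (lpar p) (0 : g) by rewrite /homog linear0.
have hM k l : M k l != 0 -> par k (+) par l = lpar p (+) lpar (p.1, p.1).
  rewrite {2}/lpar addbb addbF !mxE.
  have [/andP[/eqP-> /eqP->]//|_] := boolP ((k == p.1) && (l == p.2)).
  have [/andP[/eqP-> /eqP->]//|_] := boolP ((k == q.1) && (l == q.2)).
  by rewrite mulr0 subrr eqxx.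
have MP b y : homog b y -> lie 0 y p.1 p.1 = \sum_k \sum_l M k l * y k l.
  move=> hy; rewrite (@sum_combine K^o (fun k l => y k l)) cP subrr.
  by rewrite (lie_mx h0 hy) /= mul0mx mulmx0 scaler0 subrr mxE.
have := Ds_ad (p := (p.1, p.1)) h0 hM MP Fu.
rewrite !ad0 !linear0 add0r sum_combine => /esym/eqP.
by rewrite subr_eq0 => /eqP.
Qed.

Section Fixed.
Variables (d : nat) (z : U).
Hypotheses (z_inv : forall x, ad x z = 0) (Fz : Fil d.+1 z) (d_gt0 : (0 < d)%N).

Lemma Ds_zero_diag hs : size hs = d -> Dh hs z = 0.
Proof.
case: hs => [d0|i hs szd]; first by move: d_gt0; rewrite -d0.
pose x := frame K (lshift n i) (rshift n i); pose q : letter := (lshift n i, rshift n i).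
have hx : homog true x.
  by have := frame_homog K (lshift n i) (rshift n i); rewrite par_lshift par_rshift.
(* [ad x] crosses the diagonal letters freely and then kills [z]. *)
have E : D (lshift n i) (rshift n i) (ad x (Dh hs z)) = 0.
  have := @Ds_ad_eigen K n true x (fun=> 0) (map (@diagl n) hs) [:: q] z hx.
  rewrite big1 // scale0r addr0 z_inv linear0 linear0 => /= <- //.
    move=> _ /mapP[k _ ->]; rewrite lpar_diagl eqxx; split=> // b y hy.
    by rewrite mul0r (lie_lr_diag _ _ hy).
  by move: Fz; rewrite size_map -szd /= addn1.
have Fh : Fil (size ([::] : seq letter)).+2 (Dh hs z).
  by apply: Fil_le (Fil_Dh hs Fz); rewrite -szd /=; lia.
(* Crossing [q] instead produces -2 times the derivative along [diagl i], the other term being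
   [ad x] of a scalar. *)
have := @Ds_ad1 K n true x q (diagl i) (- 2) [::] (Dh hs z) hx _ (@lie_lr_self K n i) Fh.
have Fq : Fil 1 (D (lshift n i) (rshift n i) (Dh hs z)).
  by have := Fil_D (lshift n i) (rshift n i) Fh.
rewrite /= (ad_Fil1 _ Fq) scaler0 add0r.
rewrite E => /(_ _)/esym/eqP; rewrite scaler_eq0 oppr_eq0 pnatr_eq0 /= => H.
by apply/eqP/H; rewrite /lpar /= par_lshift par_rshift.
Qed.

(** The list [s] may contain diagonal letters too, so [k] only bounds the number of off-diagonal
    ones. *)
Lemma Ds_zero k s hs : size s = k -> (size hs + k)%N = d -> Dh hs (Ds s z) = 0.
Proof.
elim: k s hs => [|k IH] s hs; first by move/size0nil->; rewrite addn0; apply: Ds_zero_diag.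
pose double_roots : seq letter := [seq (lshift n i, rshift n i) | i <- enum 'I_n].
have front q : q \notin double_roots ->
    forall s' hs', size s' = k -> (size hs' + k.+1)%N = d ->
    Dh hs' (D q.1 q.2 (Ds s' z)) = 0.
  move=> qn s' hs' szs szd.
  have IH' t hs1 : size t = size s' -> (size hs1 + size t)%N = d -> Dh hs1 (Ds t z) = 0.
    by rewrite szs => szt; rewrite szt => /(IH _ _ szt).
  have szd' : (size hs' + (size s').+1)%N = d by rewrite szs.
  have Fq : Fil (size (map (@diagl n) hs')).+2 (Ds s' z).
    by apply: Fil_le (Fil_Ds s' Fz); rewrite size_map; lia.
  have two : (2^-1 : K) != 0 by rewrite invr_eq0 pnatr_eq0.
  have ul (i j : 'I_n) : Dh hs' (D (lshift n i) (lshift n j) (Ds s' z)) = 0.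
    have [<-|ij] := eqVneq i j.
      (* A diagonal letter joins [hs'], leaving [k] letters. *)
      have -> : Dh hs' (D (lshift n i) (lshift n i) (Ds s' z)) = Dh (rcons hs' i) (Ds s' z).
        by rewrite /Dh map_rcons Ds_rcons.
      by apply: IH => //; rewrite size_rcons; lia.
    apply: (@opposite_root K n d z z_inv Fz _ _ (lshift n i, lshift n j) 1 j i s' hs'
      (frame_homog K (lshift n j) (lshift n i))); rewrite ?oner_eq0 //= 1?eq_sym //.
      by rewrite /lpar /= !par_lshift.
    by move=> l b y hy; apply: opposite_ll hy.
  case: q qn => q1 q2; rewrite -(splitK q1) -(splitK q2).
  case: (split q1) => i; case: (split q2) => j /=.
  - by move=> _; apply: ul.
  - move=> qn; have ij : i != j.
      by apply: contra qn => /eqP->; apply: map_f; rewrite mem_enum.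
    apply: (@opposite_root K n d z z_inv Fz _ _ (lshift n i, rshift n j) _ i j s' hs'
      (frame_homog K (rshift n j) (lshift n i)) _ two) => //=.
      by rewrite /lpar /= !par_lshift !par_rshift.
    by move=> l b y hy; apply: opposite_rl hy.
  - move=> _; have [<-|ij] := eqVneq i j.
      rewrite /Dh (@Ds_lin (rshift n i, lshift n i) (rshift n i, lshift n i) 0) ?scale0r //.
      by move=> y; rewrite mul0r /= dl_diag.
    apply: (@opposite_root K n d z z_inv Fz _ _ (rshift n i, lshift n j) _ j i s' hs'
      (frame_homog K (lshift n i) (rshift n j)) _ two) => //=; last 1 first.
    + by move=> l b y hy; apply: opposite_lr hy.
    + by rewrite /lpar /= !par_lshift !par_rshift.
    + by rewrite eq_sym.
  (* The lower right block is minus the transpose of the upper left one, which is done. *)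
  - move=> _; rewrite /Dh (@Ds_lin (rshift n i, rshift n j) (lshift n j, lshift n i) (-1)) //.
    + by rewrite -/(Dh _ _) ul scaler0.
    + by rewrite /lpar /= !par_lshift !par_rshift.
    + by move=> y /=; rewrite mulN1r; have [] := periplectic_entry y i j.
move=> szs szd.
have [/hasP[q qs qn]|/hasPn sB] := boolP (has [pred q | q \notin double_roots] s).
  have Fs t : size t = k.+1 -> Fil (size (map (@diagl n) hs ++ t)).+1 z.
    by move=> szt; rewrite size_cat size_map szt szd.
  (* Bring the letter [q] to the front of [s]. *)
  have := @Ds_perm0 K n (map (@diagl n) hs ++ q :: rem q s) (map (@diagl n) hs ++ s) z.
  rewrite !Ds_cat; apply; last first.
  - by apply: front => //; rewrite size_rem // szs.
  - by rewrite perm_cat2l perm_sym; apply: perm_to_rem.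
  - by apply: Fs; rewrite /= size_rem // szs.
(* Eigenvalues of [grading] on the remaining letters; their sum is twice the size of [s], hence
   nonzero. *)
pose c (p : letter) : K := if p.1 == p.2 then 0 else 2.
have cs p : p \in s -> exists i, p = (lshift n i, rshift n i).
  by move/sB; rewrite /= negbK => /mapP[i _ ->]; exists i.
have sP p : p \in map (@diagl n) hs ++ s -> [/\ false && lpar p = false,
    c p != 0 -> false = false & forall b y, homog b y ->
    lie (grading K n) y p.1 p.2 = c p * y p.1 p.2].
  rewrite mem_cat => /orP[/mapP[i _ ->]|/cs[i ->]]; split=> // b y hy.
    by rewrite /c eqxx mul0r (lie_grading_ul _ hy).
  by rewrite /c /= eq_lrshift (lie_grading_ur _ _ hy).
have Fs : Fil (size (map (@diagl n) hs ++ s) + size ([::] : seq letter)).+1 z.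
  by rewrite addn0 size_cat size_map szs szd.
have := Ds_ad_eigen (grading_homog K n) sP Fs.
rewrite z_inv linear0 /= ad_Fil1; last first.
  have := @Fil_Ds K n d.+1 (map (@diagl n) hs ++ s) z Fz.
  by rewrite size_cat size_map szs szd subSnn.
rewrite add0r big_cat big_map /= big1 ?add0r => [|i _]; last by rewrite /c eqxx.
rewrite big_seq (eq_bigr (fun=> 2)) => [|p /cs[i ->]]; last by rewrite /c /= eq_lrshift.
rewrite -big_seq big_const_seq count_predT szs iter_addr addr0 Ds_cat.
move=> /esym/eqP; rewrite scaler_eq0 -mulrnA pnatr_eq0 /=.
by move/eqP.
Qed.

End Fixed.

(** Iterates [Fil_of_D] down to level 0, where the top derivatives are the scalars themselves. *)
Lemma Fil_of_Ds r u : Fil r.+1 u -> (forall s, size s = r -> Ds s u = 0) -> Fil r u.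
Proof.
elim: r u => [|r IH] u Fu u0; first by rewrite (u0 [::] erefl : u = 0); apply: Fil_zero.
apply: (Fil_of_D Fu) => i j; apply: IH => [|s szs].
  by have := Fil_D i j Fu; rewrite subn1.
by rewrite -(@Ds_rcons _ _ s (i, j)) u0 // size_rcons szs.
Qed.

(** All top derivatives of an invariant of positive order vanish, so its order drops until it is a
    scalar. *)
Lemma invariant_scalar z : (forall x, ad x z = 0) -> exists c : K, z = c%:A.
Proof.
move=> z_inv; have [r] := Fil_exists z; elim: r => [|r IH] Fz.
  by exists 0; rewrite scale0r (Fil0 Fz).
case: r => [|d] in IH Fz *; first exact: Fil1 Fz.
apply/IH/(Fil_of_Ds Fz) => s szs.
exact: (@Ds_zero d.+1 z z_inv Fz isT d.+1 s [::] szs).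
Qed.
End Center.

Theorem supercenter_periplectic (K : numFieldType) (n : nat) :
  supercenter (periplectic K n) = [set c%:A | c in [set: K]].
Proof.
apply/seteqP; split=> [z /= z_inv|_ /= [c _ <-] x]; last exact: ad_scale.
by have [c ->] := invariant_scalar z_inv; exists c.
Qed.

Theorem theorem3p18 (R : realType) (n : nat) :
  supercenter (periplectic R[i] n) = [set c%:A | c in [set: R[i]]].
Proof. exact: supercenter_periplectic. Qed.
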